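(* Let $G$ be a totally disconnected locally compact group with left Haar measure $\mu_G$ and modular function $\Delta_G:G\to\mathbb R_+^*$. Let $H$ be a closed subgroup of $G$ such that: 1. $H\le\ker\Delta_G$; 2. there exists a neighborhood basis $(K_n)_{n\in\mathbb N}$ at the identity of $G$ consisting of compact open subgroups such that for every nontrivial $g\in G$, $\limsup_{n}\, c_H(gK_n)\,\mu_G(K_n)^2=\infty$. Then $\mathcal L(H)'\cap\mathcal L(G)=\mathbb C$. Thus both $G$ and $H$ have a factorial left regular representation.
   Context: For a compact open subgroup $K$ of $G$ and a closed subgroup $H\le G$, $\mathcal N_H(K)=\{h\in H: hKh^{-1}=K\}$ acts by conjugation on the set $G/K$ of left cosets ($h\cdot gK=h(gK)h^{-1}=hgh^{-1}K$), and $c_H(gK)\in\mathbb N^*\cup\{\infty\}$ is the cardinality of the orbit of $gK$ under this action (with $\infty\cdot\mu_G(K)^2=\infty$). The modular function is defined by $\mu_G(Ag)=\Delta_G(g)\mu_G(A)$. $\lambda_G$ is the left regular representation on $L^2(G,\mu_G)$, $(\lambda_G(g)\xi)(x)=\xi(g^{-1}x)$, and $\mathcal L(G)=\lambda_G(G)''$. For a closed subgroup $H\le G$, $\mathcal L(H)$ is identified with $\lambda_G(H)''\subset\mathcal L(G)$, so $\mathcal L(H)'\cap\mathcal L(G)$ is the set of elements of $\mathcal L(G)$ commuting with all $\lambda_G(h)$, $h\in H$. A representation $\pi$ is factorial if $\pi(G)''$ (equivalently $\pi(G)'$) has trivial center.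
   Formalization: The neighborhood basis (K_n) is taken to be decreasing, K_{n+1} contained in K_n; for a countable neighborhood basis in arbitrary order, whose members need not shrink to the identity along n, the statement as literally read is false. *)

(* Defs.v *)
From HB Require Import structures.
From mathcomp Require Import all_boot all_order all_algebra.
From mathcomp Require Import all_classical all_reals all_analysis.
From mathcomp Require Import measurable_realfun complex.

Set Implicit Arguments.
Unset Strict Implicit.
Unset Printing Implicit Defensive.

Import Order.TTheory GRing.Theory Num.Theory.
Import numFieldNormedType.Exports.

Local Open Scope classical_set_scope.
Local Open Scope ring_scope.

HB.mixin Record isTopologicalGroup G of Topological G & Group G := {
  mulg_continuous : continuous (fun xy : G * G => (xy.1 * xy.2)%g);
  invg_continuous : continuous (fun x : G => (x^-1)%g)
}.

#[short(type="topologicalGroupType")]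
HB.structure Definition TopologicalGroup :=
  {G of Topological G & Group G & isTopologicalGroup G}.

(* A subgroup seen as a topological group in its own right, with the topology
   induced by the ambient group. *)
Definition subgroup_type (G : topologicalGroupType) (H : groupClosed G) : Type :=
  {x : G | x \in H}.

Section subgroup.
Variables (G : topologicalGroupType) (H : groupClosed G).

Lemma subgroup_closed : group_closed (fun x : G => x \in H).
Proof.
split; first exact: gpred1.
by move=> x y xH yH; apply: gpredM => //; apply: gpredVr.
Qed.

HB.instance Definition _ := SubType.on (subgroup_type H).
HB.instance Definition _ := Choice.on (subgroup_type H).
HB.instance Definition _ :=
  SubChoice_isSubGroup.Build G (fun x : G => x \in H) (subgroup_type H)
    subgroup_closed.
HB.instance Definition _ := Topological.copy (subgroup_type H)
  (initial_topology (val : subgroup_type H -> G)).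

Lemma subgroup_val_continuous : continuous (val : subgroup_type H -> G).
Proof. exact: initial_continuous. Qed.

Lemma subgroup_mulg_continuous :
  continuous (fun xy : subgroup_type H * subgroup_type H => (xy.1 * xy.2)%g).
Proof.
apply: continuous_comp_initial => xy.
apply: (@continuous2_cvg _ G G G _ _ (fun z => val z.1) (fun z => val z.2)
  (fun x y => (x * y)%g)).
- exact: (@mulg_continuous G (val xy.1, val xy.2)).
- by apply: continuous_comp; [exact: cvg_fst|exact: subgroup_val_continuous].
- by apply: continuous_comp; [exact: cvg_snd|exact: subgroup_val_continuous].
Qed.

Lemma subgroup_invg_continuous :
  continuous (fun x : subgroup_type H => (x^-1)%g).
Proof.
apply: continuous_comp_initial => x.
apply: (@continuous_comp (subgroup_type H) G G val (fun y => y^-1)%g).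
  exact: subgroup_val_continuous.
exact: (@invg_continuous G (val x)).
Qed.

HB.instance Definition _ := isTopologicalGroup.Build (subgroup_type H)
  subgroup_mulg_continuous subgroup_invg_continuous.
End subgroup.

(* [borel G] is [G] with its Borel sigma-algebra; [measurableType] requires a
   point, which is the unit. *)
Definition borel_pointed (G : topologicalGroupType) : Type := G.
HB.instance Definition _ (G : topologicalGroupType) :=
  Choice.on (borel_pointed G).
HB.instance Definition _ (G : topologicalGroupType) :=
  isPointed.Build (borel_pointed G) (1%g : G).
Definition borel (G : topologicalGroupType) :=
  g_sigma_algebraType (@open G : set (set (borel_pointed G))).
HB.instance Definition _ (G : topologicalGroupType) :=
  Measurable.on (borel G).

Section L2.
Context d (T : measurableType d) (R : realType).
Variable mu : {measure set T -> \bar R}.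

(* [|f|^2] is integrable iff the real and imaginary parts of [f] lie in the
   library's real L^2 space. *)
Definition sqint : {pred T -> R[i]} :=
  [pred f | (@complex.Re R \o f \in Lfun mu 2%:E)
         && (@complex.Im R \o f \in Lfun mu 2%:E)].

Lemma sqint_submod_closed : submod_closed sqint.
Proof.
have p1 : (1 <= 2%:E :> \bar R)%E by rewrite lee_fin ler1n.
have [L0 LZD] := Lfun_submod_closed mu p1.
have LZ a f : f \in Lfun mu 2%:E -> a \*: f \in Lfun mu 2%:E.
  by move=> Lf; have := LZD a f 0 Lf L0; rewrite addr0.
have LD f g : f \in Lfun mu 2%:E -> g \in Lfun mu 2%:E ->
    f + g \in Lfun mu 2%:E.
  by move=> Lf Lg; have := LZD 1 f g Lf Lg; rewrite scale1r.
split; first by apply/andP.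
move=> a f g /andP[fr fi] /andP[gr gi]; apply/andP; split.
  have -> : @complex.Re R \o (a *: f + g) =
      (complex.Re a \*: (@complex.Re R \o f)
       + (- complex.Im a) \*: (@complex.Im R \o f)) + (@complex.Re R \o g).
    apply/funext => x; rewrite /= !fctE.
    rewrite -[RHS]/(_ * _ + - _ * _ + _) mulNr /=.
    by case: a (f x) (g x) => [? ?] [? ?] [? ?].
  by apply: (LD) => //; apply: LD; exact: LZ.
have -> : @complex.Im R \o (a *: f + g) =
    (complex.Re a \*: (@complex.Im R \o f)
     + complex.Im a \*: (@complex.Re R \o f)) + (@complex.Im R \o g).
  apply/funext => x; rewrite /= !fctE.
  rewrite -[RHS]/(_ * _ + _ * _ + _) /=.
  by case: a (f x) (g x) => [? ?] [? ?] [? ?].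
by apply: (LD) => //; apply: LD; exact: LZ.
Qed.

HB.instance Definition _ := GRing.isSubmodClosed.Build _ _ sqint
  sqint_submod_closed.

Definition sqintType : Type := {f : T -> R[i] | f \in sqint}.
HB.instance Definition _ := SubType.on sqintType.
HB.instance Definition _ := Choice.on sqintType.
HB.instance Definition _ := [SubChoice_isSubLmodule of sqintType by <:].

Definition sqint_null : {pred sqintType} :=
  [pred f | `[< val f = cst 0 %[ae mu] >]].

Lemma sqint_null_zmod_closed : zmod_closed sqint_null.
Proof.
split; first by apply/asboolP; exact: ae_eq_refl.
move=> f g /asboolP f0 /asboolP g0; apply/asboolP.
by apply: filterS2 f0 g0 => x /(_ I) fx /(_ I) gx _; rewrite -[LHS]/(val f x - val g x) fx gx subrr.
Qed.

HB.instance Definition _ := GRing.isZmodClosed.Build _ sqint_null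
  sqint_null_zmod_closed.

Definition L2 : Type := Quotient.quot sqint_null.
HB.instance Definition _ := GRing.Zmodule.on L2.

Definition L2_class (f : sqintType) : L2 := (\pi_(Quotient.quot sqint_null) f)%qT.

Lemma L2_classP f g :
  reflect (val f = val g %[ae mu]) (L2_class f == L2_class g).
Proof.
rewrite /L2_class -Quotient.idealrBE; apply: (iffP (asboolP _)).
  apply: filterS => x /(_ I); rewrite -[LHS]/(val f x - val g x) => /eqP.
  by rewrite subr_eq0 => /eqP.
by apply: filterS => x /(_ I) fg _; rewrite -[LHS]/(val f x - val g x) fg subrr.
Qed.

Lemma L2_repr_class f : val (repr (L2_class f)) = val f %[ae mu].
Proof. by apply/L2_classP; rewrite /L2_class reprK. Qed.

Lemma L2_classD f g : L2_class (f + g) = L2_class f + L2_class g.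
Proof. exact: Quotient.pi_add. Qed.

Definition L2_scale (a : R[i]) (xi : L2) : L2 := L2_class (a *: repr xi).

Lemma L2_scaleE a f : L2_scale a (L2_class f) = L2_class (a *: f).
Proof.
apply/eqP/L2_classP; apply: filterS (L2_repr_class f) => x /(_ I) fx _.
by rewrite -[LHS]/(a * val (repr (L2_class f)) x) fx.
Qed.

Lemma L2_ind (P : L2 -> Prop) : (forall f, P (L2_class f)) -> forall xi, P xi.
Proof. by move=> Pc xi; rewrite -[xi]reprK; exact: Pc. Qed.

Lemma L2_scaleA a b xi : L2_scale a (L2_scale b xi) = L2_scale (a * b) xi.
Proof. by elim/L2_ind: xi => f; rewrite !L2_scaleE scalerA. Qed.

Lemma L2_scale1 : left_id 1 L2_scale.
Proof. by elim/L2_ind => f; rewrite L2_scaleE scale1r. Qed.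

Lemma L2_scaleDr : right_distributive L2_scale +%R.
Proof.
move=> a; elim/L2_ind => f; elim/L2_ind => g.
by rewrite -L2_classD !L2_scaleE scalerDr L2_classD.
Qed.

Lemma L2_scaleDl xi : {morph L2_scale^~ xi : a b / a + b}.
Proof.
by move=> a b; elim/L2_ind: xi => f; rewrite !L2_scaleE scalerDl L2_classD.
Qed.

HB.instance Definition _ := GRing.Zmodule_isLmodule.Build R[i] L2
  L2_scaleA L2_scale1 L2_scaleDr L2_scaleDl.

Definition L2_norm (xi : L2) : R :=
  fine ('N[mu]_2%:E[EFin \o (@Normc.normc R) \o val (repr xi)])%E.

Definition bounded_op (A : L2 -> L2) :=
  linear A /\ exists M : R, forall xi, L2_norm (A xi) <= M * L2_norm xi.

Definition scalar_ops : set (L2 -> L2) :=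
  [set A | exists c : R[i], A = fun xi => c *: xi].

Definition commutant (S : set (L2 -> L2)) : set (L2 -> L2) :=
  [set A | bounded_op A /\ forall B, S B -> A \o B = B \o A].

Definition bicommutant (S : set (L2 -> L2)) := commutant (commutant S).

(* The representation [pi] is factorial: its von Neumann algebra
   [pi(I)''] has trivial center. *)
Definition is_factorial (I : Type) (pi : I -> L2 -> L2) :=
  bicommutant (range pi) `&` commutant (bicommutant (range pi)) = scalar_ops.

End L2.

Section haar.
Variables (G : topologicalGroupType) (R : realType).
Variable mu : {measure set (borel G) -> \bar R}.

(* Left Haar measures are Radon measures: outer regular on Borel sets and inner
   regular on open sets; this matters since [G] need not be sigma-compact. *)
Record left_haar : Prop := LeftHaar {
  haar_neq0 : mu setT != 0%E;
  haar_compact : forall K : set G, compact K -> (mu K < +oo)%E;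
  haar_outer : forall A : set (borel G), measurable A ->
    mu A = ereal_inf [set mu U | U in [set U : set G | open U /\ A `<=` U]];
  haar_inner : forall U : set G, open U ->
    mu U = ereal_sup [set mu K | K in [set K : set G | compact K /\ K `<=` U]];
  haar_left : forall (g : G) (A : set (borel G)), measurable A ->
    mu [set (g * x)%g | x in A : set G] = mu A
}.

Definition modular_function (Delta : G -> R) :=
  forall g, 0 < Delta g /\ forall A : set (borel G), measurable A ->
    mu [set (x * g)%g | x in A : set G] = ((Delta g)%:E * mu A)%E.

Lemma measurable_mulgl (g : G) :
  measurable_fun setT ((fun x : G => (g * x)%g) : borel G -> borel G).
Proof.
apply: (@measurability _ _ (borel G) (borel G) setT _ (@open G)) => // _ [U oU <-].
rewrite setTI; apply: sub_sigma_algebra.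
apply: (@open_comp G G) oU => x _.
apply: (@continuous2_cvg _ G G G _ _ (fun=> g) id (fun x y => (x * y)%g)).
- exact: (@mulg_continuous G (g, x)).
- exact: cvg_cst.
- exact: cvg_id.
Qed.

Definition ltrans (g : G) (f : G -> R[i]) (x : G) : R[i] := f (g^-1 * x)%g.

Hypothesis hmu : left_haar.

Lemma integral_mulgl (g : G) (F : borel G -> \bar R) :
    measurable_fun [set: borel G] F -> (forall x, 0 <= F x)%E ->
  (\int[mu]_x F (g^-1 * x)%g = \int[mu]_x F x)%E.
Proof.
move=> mF F0; pose phi : borel G -> borel G := fun x : G => (g^-1 * x)%g.
have mphi : measurable_fun setT phi by exact: measurable_mulgl.
have := @ge0_integral_pushforward _ _ _ _ _ phi mphi mu setT F measurableT mF
  (fun x _ => F0 x).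
rewrite preimage_setT => <-.
apply: eq_measure_integral => A mA _; rewrite -(haar_left hmu g mA).
congr (mu _); apply/seteqP; split=> [x Ax|_ [x Ax <-]].
  by exists (g^-1 * x)%g => //; rewrite mulVKg.
by rewrite /preimage/= /phi mulKg.
Qed.

Lemma ltrans_Lfun g (h : borel G -> R) : h \in Lfun mu 2%:E ->
  ((fun x : G => h (g^-1 * x)%g) : borel G -> R) \in Lfun mu 2%:E.
Proof.
move=> /andP[]; rewrite inE/= => mh; rewrite inE/= => fh; apply/andP; split.
  rewrite inE/=.
  by apply: (@measurableT_comp _ _ _ (borel G) (borel G)) => //;
    exact: measurable_mulgl.
rewrite inE/= /finite_norm; move: fh; rewrite /finite_norm !unlock.
set F := fun x : borel G => (`|(EFin \o h) x| `^ 2)%E.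
suff <- : (\int[mu]_x F (g^-1 * x)%g = \int[mu]_x F x)%E by [].
apply: integral_mulgl => [|x]; last exact: poweR_ge0.
apply: (@measurableT_comp _ _ _ _ _ _ (fun y => poweR y 2)).
  exact: measurable_poweR.
apply: (@measurableT_comp _ _ _ _ _ _ abse); last exact/measurable_EFinP.
exact: abse_measurable.
Qed.

Lemma ltrans_sqint g (f : sqintType mu) : ltrans g (val f) \in sqint mu.
Proof.
by case: f => f /= /andP[fr fi]; apply/andP; split;
  [exact: (ltrans_Lfun g fr)|exact: (ltrans_Lfun g fi)].
Qed.

Definition L2_ltrans (g : G) (f : sqintType mu) : sqintType mu :=
  Sub (ltrans g (val f)) (ltrans_sqint g f).

Definition left_regular (g : G) (xi : L2 mu) : L2 mu :=
  L2_class (L2_ltrans g (repr xi)).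

Lemma left_regularE g f :
  left_regular g (L2_class f) = L2_class (L2_ltrans g f).
Proof.
apply/eqP/L2_classP.
have [N [mN N0 sN]] := L2_repr_class f.
exists [set (g * x)%g | x in N : set G]; split.
- have -> : [set (g * x)%g | x in N : set G] =
      setT `&` ((fun x : G => (g^-1 * x)%g) : borel G -> borel G) @^-1` N.
    rewrite setTI; apply/seteqP; split=> [_ [x Nx <-]|x Nx].
      by rewrite /preimage/= mulKg.
    by exists (g^-1 * x)%g => //; rewrite mulVKg.
  exact: measurable_mulgl.
- by rewrite haar_left.
- move=> x fx; exists (g^-1 * x)%g; last by rewrite mulVKg.
  by apply: sN => fgx; apply: fx => _; exact: fgx.
Qed.

End haar.

Section conjugation.
Variables (G : groupType) (R : realType).
Implicit Types (K A : set G) (H : {pred G}) (g h : G).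

Definition lcoset g K : set G := [set (g * k)%g | k in K].

Definition conjset h A : set G := [set (h * x * h^-1)%g | x in A].

Definition normalizer_in H K : set G := [set h | h \in H /\ conjset h K = K].

(* [counting] is the cardinality, with value [+oo] on infinite sets. *)
Definition conj_orbit_card H K g : \bar R :=
  counting [set conjset h (lcoset g K) | h in normalizer_in H K].

End conjugation.

(* A neighborhood basis of the identity indexed by [nat] is nonincreasing, so
   that a limit superior along [n] is taken as [K n] shrinks to the identity. *)
Definition nbhs_basis1 (G : topologicalGroupType) (K : nat -> set G) :=
  (forall n, nbhs (1%g : G) (K n)) /\
  (forall n, K n.+1 `<=` K n) /\
  (forall U, nbhs (1%g : G) U -> exists n, K n `<=` U).

(* Main.v *)
Require Import Defs.
From HB Require Import structures.
From mathcomp Require Import all_boot all_order all_algebra.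
From mathcomp Require Import all_classical all_reals all_analysis.
From mathcomp Require Import measurable_realfun complex.
From mathcomp Require Import ring lra.

Set Implicit Arguments.
Unset Strict Implicit.
Unset Printing Implicit Defensive.

Import Order.TTheory GRing.Theory Num.Theory.
Import numFieldNormedType.Exports.

Local Open Scope classical_set_scope.
Local Open Scope ring_scope.

(** The idea is to recover an operator of the relative commutant from the
    finitely additive distribution that it attaches to the unit of [G].

    Let [T] lie in the bicommutant of the left translations of [G] and commute
    with those of [H].  Right translations commute with left ones, so [T]
    commutes with every right translation.  Write [e A] for the class of the
    indicator of [A], [v n] for the volume of [K n], and consider
    [mass n x = <T (e (K n)), e (x K_n)> / v n], which one reads as the mass that
    the formal image of the Dirac mass at [1] gives to the coset [x K_n].
    Cutting [K n] into right cosets of a smaller [K l] and moving them onto one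
    another by right translations shows that this mass is consistent from one
    level to the next, hence additive ([ip_refine_left], [ip_refine_right]).

    If [h] lies in [H] and normalizes [K n], then [T] commutes with the
    conjugation by [h], which fixes [e (K n)], so [mass n] is constant along the
    orbits of these [h].  An orbit of [p] disjoint cosets then gives
    [p * (mass n x)^2 <= ||T||^2] by Cauchy-Schwarz ([orbit_bound]), i.e. the mass
    per volume [mass n x / v n] is at most [||T|| / sqrt (p * (v n)^2)].  By the
    hypothesis on orbits, every [x != 1] therefore has arbitrarily small cosets
    of arbitrarily small mass per volume.  A compact coset that avoids [1] is
    covered by such cosets of bounded level, and additivity propagates the bound
    back to the coset itself: its mass vanishes ([mass_outside]).  There is no
    passage to a density at a point, so it does not matter that the good levels
    depend on [x].

    Hence [T (e (K n))] is orthogonal to every coset outside [K n] and has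
    constant pairing with the small cosets inside; indicators of cosets span a
    dense subspace ([dense_cosets]), so [T (e (K n)) = c *: e (K n)], with [c]
    independent of [n].  Right translating and using density again gives
    [T = c] ([commuting_scalar]).

    The factoriality of [G] is a special case, because the center of the von
    Neumann algebra of [G] lies in the relative commutant of that of [H].  For
    [H], the same argument runs on [H] acting on itself, with the subgroups
    [K n] intersected with [H]: the volume of the intersection is at least a
    constant times the volume of [K n] ([vol_trace_ge]), and distinct conjugates
    stay distinct ([many_conjugates_trace]), so the hypothesis on orbits is
    inherited.  This avoids comparing the two regular representations of [H],
    and only asks for the modular function of [H], which is constructed from
    volumes of translated compact open sets ([modular_function_exists]). *)

(** * The real inner product of L2 *)

Section inner_product.
Context d (T : measurableType d) (R : realType).
Variable mu : {measure set T -> \bar R}.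
Implicit Types (f g : T -> R[i]) (xi eta zeta : L2 mu).

Let Re (z : R[i]) : R := complex.Re z.
Let Im (z : R[i]) : R := complex.Im z.

Lemma ReD (z w : R[i]) : Re (z + w) = Re z + Re w.
Proof. by case: z w => [? ?] [? ?]. Qed.
Lemma ImD (z w : R[i]) : Im (z + w) = Im z + Im w.
Proof. by case: z w => [? ?] [? ?]. Qed.
Lemma ReM (z w : R[i]) : Re (z * w) = Re z * Re w - Im z * Im w.
Proof. by case: z w => [? ?] [? ?]. Qed.
Lemma ImM (z w : R[i]) : Im (z * w) = Re z * Im w + Im z * Re w.
Proof. by case: z w => [? ?] [? ?]. Qed.

Definition ip_fun f g (x : T) : R := Re (f x) * Re (g x) + Im (f x) * Im (g x).

Lemma ip_fun_integrable f g : f \in sqint mu -> g \in sqint mu ->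
  mu.-integrable setT (EFin \o ip_fun f g).
Proof.
move=> /andP[fr fi] /andP[gr gi].
have -> : EFin \o ip_fun f g =
   (EFin \o ((Re \o f) \* (Re \o g))) \+ (EFin \o ((Im \o f) \* (Im \o g))).
  by apply/funext => x /=; rewrite EFinD.
by apply: integrableD => //; apply/Lfun1_integrable; exact: Lfun2_mul_Lfun1.
Qed.

Lemma ip_fun_measurable f g : f \in sqint mu -> g \in sqint mu ->
  measurable_fun setT (EFin \o ip_fun f g).
Proof. by move=> Lf Lg; case/integrableP: (ip_fun_integrable Lf Lg). Qed.

(** The real part of the Hermitian product.  It is real bilinear and has the
    same norm, and its imaginary counterpart is recovered by multiplying one
    argument by ['i], see [ipJ]. *)
Definition ip xi eta : R :=
  \int[mu]_x ip_fun (val (repr xi)) (val (repr eta)) x.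

Lemma ipE (f g : sqintType mu) :
  ip (L2_class f) (L2_class g) = \int[mu]_x ip_fun (val f) (val g) x.
Proof.
rewrite /ip /Rintegral; congr fine.
apply: ae_eq_integral => //;
  [exact: (ip_fun_measurable (valP _) (valP _))..|].
have := L2_repr_class f; have := L2_repr_class g.
apply: filterS2 => x /(_ I) gx /(_ I) fx _.
by rewrite /ip_fun fx gx.
Qed.

Lemma ipC xi eta : ip xi eta = ip eta xi.
Proof.
by rewrite /ip; apply: eq_Rintegral => x _; rewrite /ip_fun; ring.
Qed.

Lemma ipDl xi eta zeta : ip (xi + eta) zeta = ip xi zeta + ip eta zeta.
Proof.
elim/L2_ind: xi => f; elim/L2_ind: eta => g; elim/L2_ind: zeta => h.
rewrite -L2_classD !ipE -RintegralD//;
  [|exact: (ip_fun_integrable (valP _) (valP _))..].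
apply: eq_Rintegral => x _; rewrite /ip_fun.
rewrite -[val (f + g) x]/(val f x + val g x) ReD ImD; ring.
Qed.

Lemma ipZ (a : R) xi eta : ip (a%:C%C *: xi) eta = a * ip xi eta.
Proof.
elim/L2_ind: xi => f; elim/L2_ind: eta => g.
rewrite -[_ *: L2_class f]/(L2_scale _ _) L2_scaleE !ipE -RintegralZl//;
  last exact: (ip_fun_integrable (valP _) (valP _)).
apply: eq_Rintegral => x _; rewrite /ip_fun.
rewrite -[val (a%:C%C *: f) x]/(a%:C%C * val f x) ReM ImM /=; ring.
Qed.

Lemma ipJ xi eta : ip ('i%C *: xi) eta = - ip xi ('i%C *: eta).
Proof.
rewrite -[RHS]mulN1r -ipZ.
elim/L2_ind: xi => f; elim/L2_ind: eta => g.
rewrite -![_ *: L2_class _]/(L2_scale _ _) !L2_scaleE !ipE.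
apply: eq_Rintegral => x _; rewrite /ip_fun.
rewrite -[val ((- 1)%:C%C *: f) x]/((-1)%:C%C * val f x).
rewrite -[val ('i%C *: f) x]/('i%C * val f x).
rewrite -[val ('i%C *: g) x]/('i%C * val g x).
rewrite !ReM !ImM /=; ring.
Qed.

Lemma ip0l xi : ip 0 xi = 0.
Proof. by rewrite -(scale0r 0) -[0]/(0%:C%C) ipZ mul0r. Qed.

Lemma ipDr xi eta zeta : ip zeta (xi + eta) = ip zeta xi + ip zeta eta.
Proof. by rewrite ipC ipDl !(ipC zeta). Qed.

Lemma ipNl xi eta : ip (- xi) eta = - ip xi eta.
Proof. by apply/eqP; rewrite -addr_eq0 -ipDl addNr ip0l. Qed.

Lemma ipZr (a : R) xi eta : ip xi (a%:C%C *: eta) = a * ip xi eta.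
Proof. by rewrite ipC ipZ ipC. Qed.

Lemma ip_sumr I (s : seq I) (F : I -> L2 mu) xi :
  ip xi (\sum_(i <- s) F i) = \sum_(i <- s) ip xi (F i).
Proof.
apply: (big_morph (ip xi) (fun x y => ipDr x y xi)).
by rewrite ipC ip0l.
Qed.

Lemma ip_ge0 xi : 0 <= ip xi xi.
Proof.
apply: Rintegral_ge0 => x _; rewrite /ip_fun -!expr2.
by rewrite addr_ge0// sqr_ge0.
Qed.

Lemma ip_norm xi : ip xi xi = L2_norm xi ^+ 2.
Proof.
rewrite /ip /L2_norm; set f := val (repr xi).
have Lf : f \in sqint mu by exact: valP.
have E : ((\int[mu]_x (ip_fun f f x)%:E) =
    ('N[mu]_2%:E[EFin \o (@Normc.normc R) \o f]) `^ 2)%E.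
  rewrite poweR_Lnorm//; apply: eq_integral => x _ /=.
  rewrite ger0_norm; last by rewrite /Normc.normc; case: (f x) => ? ?; exact: sqrtr_ge0.
  rewrite powR_mulrn; last by rewrite /Normc.normc; case: (f x) => ? ?; exact: sqrtr_ge0.
  rewrite /ip_fun /Normc.normc; case: (f x) => a b /=.
  by rewrite sqr_sqrtr ?addr_ge0 ?sqr_ge0// !expr2.
rewrite /Rintegral E.
have := integrable_fin_num measurableT (ip_fun_integrable Lf Lf).
rewrite /comp E.
case: ('N[mu]_2%:E[_])%E (Lnorm_ge0 mu 2%:E (EFin \o (@Normc.normc R) \o f)) => //=.
  by move=> r; rewrite lee_fin => r0 _; rewrite powR_mulrn.
by rewrite pnatr_eq0.
Qed.

Lemma ip_eq0 xi : ip xi xi = 0 -> xi = 0.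
Proof.
elim/L2_ind: xi => f; rewrite ipE /Rintegral => i0.
have ff : ip_fun (val f) (val f) = 0 %[ae mu].
  have ge0 x : 0 <= ip_fun (val f) (val f) x.
    by rewrite /ip_fun -!expr2 addr_ge0// sqr_ge0.
  have := integrable_fin_num measurableT (ip_fun_integrable (valP f) (valP f)).
  rewrite /comp => /fineK; rewrite i0 => /esym i00.
  have : EFin \o ip_fun (val f) (val f) = cst 0%E %[ae mu].
    apply/ae_eq_integral_abs => //; first exact: (ip_fun_measurable (valP f) (valP f)).
    rewrite -[RHS]i00; apply: eq_integral => x _ /=.
    by rewrite ger0_norm.
  by apply: filterS => x /(_ I)/= [] + _.
have -> : 0 = L2_class (0 : sqintType mu).
  by apply: (addrI (L2_class 0)); rewrite addr0 -L2_classD addr0.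
apply/eqP/L2_classP; move: ff; apply: filterS => x /(_ I) + _.
rewrite /ip_fun -!expr2 => /eqP; rewrite paddr_eq0 ?sqr_ge0//.
rewrite !sqrf_eq0 -[RHS]/(0 : R[i]) => /andP[/eqP a /eqP b].
by move: a b; case: (val f x) => u v /= -> ->.
Qed.

Lemma ip_scaled_norm (a b : R) xi eta :
  ip (a%:C%C *: xi + b%:C%C *: eta) (a%:C%C *: xi + b%:C%C *: eta) =
  a ^+ 2 * ip xi xi + 2 * a * b * ip xi eta + b ^+ 2 * ip eta eta.
Proof. rewrite !(ipDl, ipDr) !(ipZ, ipZr) (ipC eta xi); ring. Qed.

Lemma cauchy_schwarz xi eta : ip xi eta ^+ 2 <= ip xi xi * ip eta eta.
Proof.
have h a b : 0 <= a ^+ 2 * ip xi xi + 2 * a * b * ip xi eta + b ^+ 2 * ip eta eta.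
  by rewrite -ip_scaled_norm ip_ge0.
have x0 := ip_ge0 xi; have [e0|e1] := eqVneq eta 0.
  by rewrite e0 ipC ip0l expr0n/= mulr_ge0// ip_ge0.
have e0 : 0 < ip eta eta.
  by rewrite lt_neqAle ip_ge0 andbT eq_sym; apply: contra e1 => /eqP/ip_eq0 ->.
(* This combination of [xi] and [eta] is orthogonal to [eta]. *)
have := h (ip eta eta) (- ip xi eta).
set A := ip xi xi; set B := ip eta eta; set C := ip xi eta => h'.
have : 0 <= B * (A * B - C ^+ 2).
  by apply: le_trans h' _; rewrite le_eqVlt; apply/orP; left; apply/eqP; ring.
by rewrite pmulr_rge0// subr_ge0.
Qed.

(** Reduces complex scalars to real ones and ['i], which is all that [ip] sees. *)
Lemma scaleCE (z : R[i]) xi :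
  z *: xi = (complex.Re z)%:C%C *: xi + (complex.Im z)%:C%C *: ('i%C *: xi).
Proof. by rewrite scalerA -scalerDl; congr (_ *: _); case: z => a b; simpc. Qed.

Lemma ip_scale z xi : ip (z *: xi) (z *: xi) =
  (complex.Re z ^+ 2 + complex.Im z ^+ 2) * ip xi xi.
Proof.
rewrite scaleCE ip_scaled_norm ipJ.
have -> : ip xi ('i%C *: xi) = 0.
  by have := ipJ xi xi; rewrite ipC; lra.
rewrite scalerA.
have -> : ('i * 'i = (-1)%:C :> R[i])%C by simpc.
rewrite ipZr; ring.
Qed.

Lemma bounded_op_ip A : bounded_op A ->
  exists2 M, 0 <= M & forall xi, ip (A xi) (A xi) <= M * ip xi xi.
Proof.
move=> [_ [M hM]]; exists (M ^+ 2); first exact: sqr_ge0.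
move=> xi; rewrite !ip_norm -exprMn.
have n0 (z : L2 mu) : 0 <= L2_norm z by rewrite fine_ge0// Lnorm_ge0.
by rewrite ler_pXn2r ?nnegrE ?n0//; apply: le_trans (hM xi).
Qed.

Lemma ip_bounded_op A M : linear A ->
  (forall xi, ip (A xi) (A xi) <= M * ip xi xi) -> bounded_op A.
Proof.
move=> lA hM; split=> //; exists (Num.sqrt (Num.max M 0)) => xi.
have n0 (z : L2 mu) : 0 <= L2_norm z by rewrite fine_ge0// Lnorm_ge0.
have M0 : 0 <= Num.max M 0 by rewrite le_max lexx orbT.
rewrite -(@ler_pXn2r _ 2) ?nnegrE ?n0// ?mulr_ge0 ?sqrtr_ge0//.
rewrite exprMn sqr_sqrtr// -!ip_norm; apply: le_trans (hM xi) _.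
by rewrite ler_wpM2r ?ip_ge0// le_max lexx.
Qed.

Lemma Lfun2P (h : T -> R) : measurable_fun setT h ->
  (\int[mu]_x ((h x) ^+ 2)%:E < +oo)%E -> h \in Lfun mu 2%:E.
Proof.
move=> mh fh; apply/andP; split; rewrite inE//=.
rewrite /finite_norm unlock; apply: poweR_lty.
rewrite (eq_integral (fun x => (h x ^+ 2)%:E)) => [//|x _ /=].
by rewrite powR_mulrn// real_normK// num_real.
Qed.

Lemma Lfun2_le (g h : T -> R) : g \in Lfun mu 2%:E -> measurable_fun setT h ->
  (forall x, h x ^+ 2 <= g x ^+ 2) -> h \in Lfun mu 2%:E.
Proof.
move=> Lg mh hg; apply: Lfun2P => //.
have /integrableP[_] := Lfun2_integrable_sqr Lg; apply: le_lt_trans.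
apply: ge0_le_integral => //=.
- by move=> x _; rewrite lee_fin sqr_ge0.
- by apply/measurable_EFinP; exact: measurable_funX.
- have := Lg; rewrite inE => /andP[/[!inE]/= mg _].
  by apply/measurable_EFinP; apply: measurableT_comp => //; exact: measurable_funX.
- by move=> x _; rewrite lee_fin ger0_norm ?sqr_ge0.
Qed.

Lemma Lfun2_measurable (g : T -> R) : g \in Lfun mu 2%:E -> measurable_fun setT g.
Proof. by rewrite inE => /andP[/[!inE]]. Qed.

Definition realC (h : T -> R) : T -> R[i] := fun x => (h x)%:C%C.

Lemma realC_sqint (h : T -> R) : h \in Lfun mu 2%:E -> realC h \in sqint mu.
Proof.
move=> Lh; apply/andP; split; first by rewrite (_ : _ \o _ = h).
rewrite (_ : _ \o _ = 0); last by apply/funext.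
have p1 : (1 <= 2%:E :> \bar R)%E by rewrite lee_fin ler1n.
exact: (Lfun_submod_closed mu p1).1.
Qed.

(** The default value [0] of [insubd] makes this total, so that classes can be
    manipulated without carrying proofs of square integrability. *)
Definition L2_of (f : T -> R[i]) : L2 mu := L2_class (insubd 0 f).

Lemma L2_class_eq (f g : sqintType mu) : val f =1 val g -> L2_class f = L2_class g.
Proof. by move=> fg; congr L2_class; apply: val_inj; exact/funext. Qed.

Lemma L2_ofE f (Lf : f \in sqint mu) : L2_of f = L2_class (Sub f Lf).
Proof.
rewrite /L2_of; congr L2_class; apply: val_inj => /=.
by rewrite -[LHS]/(val (insubd (0 : sqintType mu) f)) insubdK.
Qed.

Lemma L2_of_val (f : sqintType mu) : L2_of (val f) = L2_class f.
Proof. by rewrite L2_ofE; [exact: valP|move=> p; congr L2_class; exact: val_inj]. Qed.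

Lemma L2_of0 : L2_of (fun=> 0) = 0.
Proof.
have L0 : (fun=> 0) \in sqint mu by exact: rpred0.
rewrite (L2_ofE L0); apply: (addrI (L2_class 0)); rewrite addr0 -L2_classD.
by apply: L2_class_eq => x; rewrite -[LHS]/(0 + 0) addr0.
Qed.

Lemma L2_ofD f g : f \in sqint mu -> g \in sqint mu -> L2_of (f \+ g) = L2_of f + L2_of g.
Proof.
move=> Lf Lg; rewrite (L2_ofE Lf) (L2_ofE Lg) -L2_classD.
have Lfg : f \+ g \in sqint mu by exact: rpredD.
by rewrite (L2_ofE Lfg); apply: L2_class_eq.
Qed.

Lemma L2_ofZ z f : f \in sqint mu -> L2_of (fun x => z * f x) = z *: L2_of f.
Proof.
move=> Lf; rewrite (L2_ofE Lf) -[RHS]/(L2_scale _ _) L2_scaleE.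
have Lzf : (fun x => z * f x) \in sqint mu by exact: (rpredZ z Lf).
by rewrite (L2_ofE Lzf); apply: L2_class_eq.
Qed.

Lemma ip_L2_of f g : f \in sqint mu -> g \in sqint mu ->
  ip (L2_of f) (L2_of g) = \int[mu]_x ip_fun f g x.
Proof. by move=> Lf Lg; rewrite (L2_ofE Lf) (L2_ofE Lg) ipE. Qed.

End inner_product.

(** * Coset systems and compact open subgroups *)

(** Common to left and to right cosets of a decreasing basis of open subgroups:
    at each level the sets partition the space, and they shrink to points. *)
Record coset_system (T : topologicalType) (c : nat -> T -> set T) : Prop := {
  cs_open : forall n x, open (c n x);
  cs_refl : forall n x, c n x x;
  cs_eq : forall n x y, c n x y -> c n y = c n x;
  cs_dec : forall n x, c n.+1 x `<=` c n x;
  cs_basis : forall U x, open U -> U x -> exists n, c n x `<=` U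
}.

Lemma compact_increasing (T : topologicalType) (C : set T) (V : nat -> set T) :
  compact C -> (forall n, open (V n)) -> (forall n, V n `<=` V n.+1) ->
  (forall x, C x -> exists n, V n x) -> exists n, C `<=` V n.
Proof.
move=> cC oV incV CV.
have homoV : {homo V : m n / (m <= n)%N >-> m `<=` n}.
  by apply: homo_leq => [A|B A D AB BD|//] x; [|move=> /AB/BD].
suff [N _ h] : \forall n \near \oo, C `<=` V n by exists N; exact: (h N (leqnn N)).
have /compact_near_coveringP ncC := cC.
apply: (ncC nat \oo V _) => x /CV[n Vnx].
exists (V n, [set m | (n <= m)%N]) => /=.
  by split; [exact: open_nbhs_nbhs|exists n].
by move=> [y m] /= [Vy nm]; exact: (homoV _ _ nm).
Qed.

Section coset_systems.
Context (T : topologicalType) (c : nat -> T -> set T) (cs : coset_system c).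

Lemma cs_homo m n x : (m <= n)%N -> c n x `<=` c m x.
Proof.
elim: n => [|n IH]; first by rewrite leqn0 => /eqP->.
rewrite leq_eqVlt => /predU1P[->//|]; rewrite ltnS => /IH h.
exact: subset_trans (cs_dec cs (x:=x)) h.
Qed.

(** A finite subcover of [A] by cosets of level [n], obtained by covering along
    the filter of finite sequences that contain a given one; then one keeps one
    representative of each coset. *)
Lemma compact_cosets n (A : set T) : compact A -> exists s : seq T,
  [/\ uniq s, forall x, x \in s -> A x,
      {in s &, forall x y, c n x y -> x = y} &
      forall y, A y -> exists2 x, x \in s & c n x y].
Proof.
move=> /compact_near_coveringP cA.
pose F : set_system (seq T) :=
  [set S | exists l : seq T, forall l' : seq T, {subset l <= l'} -> S l'].
have FF : Filter F.
  split; first by exists [::].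
    move=> P Q [l hl] [m hm]; exists (l ++ m) => l' sub; split.
      by apply: hl => x xl; apply: sub; rewrite mem_cat xl.
    by apply: hm => x xl; apply: sub; rewrite mem_cat xl orbT.
  by move=> P Q PQ [l hl]; exists l => l' /hl/PQ.
have [D Dcov] : exists D : seq T, forall y, A y ->
    exists x, [/\ x \in D, A x & c n x y].
  have [l hl] : \near F, A `<=` [set y | exists x, [/\ x \in F, A x & c n x y]].
    apply: (cA _ F (fun l y => exists x, [/\ x \in l, A x & c n x y])) => x Ax.
    exists (c n x, [set l : seq T | x \in l]) => /=.
      split; first by apply: open_nbhs_nbhs; split; [exact: cs_open|exact: cs_refl].
      by exists [:: x] => l; apply; exact: mem_head.
    by move=> [y l] /= [cxy xl]; exists x.
  by exists l => y /(hl l (fun x => id)).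
suff [s [us sA sep scov]] : exists s : seq T, [/\ uniq s, forall x, x \in s -> A x,
    {in s &, forall x y, c n x y -> x = y} &
    {in D, forall y, A y -> exists2 x, x \in s & c n x y}].
  exists s; split=> // y Ay.
  have [x [xD Ax cxy]] := Dcov _ Ay; have [z zs czx] := scov _ xD Ax.
  by exists z => //; rewrite -(cs_eq cs czx).
elim: D {Dcov} => [|a l [s [us sA sep scov]]]; first by exists [::].
have [[x xs cxa]|no] := pselect (exists2 x, x \in s & A a -> c n x a).
  exists s; split=> // y; rewrite inE => /predU1P[->|yl]; last exact: scov.
  by move=> /cxa; exists x.
have [Aa|nAa] := pselect (A a); last first.
  exists s; split=> // y; rewrite inE => /predU1P[->//|yl]; exact: scov.
exists (a :: s); split=> /=.
- rewrite us andbT; apply: contra_notN no => ain; exists a => // _; exact: cs_refl.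
- by move=> x; rewrite inE => /predU1P[->|/sA].
- move=> x y; rewrite !inE => /predU1P[->|xs] /predU1P[->|ys] // cxy.
  + by exfalso; apply: no; exists y => // _; rewrite (cs_eq cs cxy); exact: cs_refl.
  + by exfalso; apply: no; exists x.
  + exact: sep.
- move=> y; rewrite inE => /predU1P[-> _|yl Ay].
    by exists a; [rewrite mem_head|exact: cs_refl].
  by have [x xs cxy] := scov _ yl Ay; exists x => //; rewrite inE xs orbT.
Qed.

(** The points whose coset of level [n] lies in [U] form an open set that
    increases with [n]; compactness makes one level work for all of [C]. *)
Lemma compact_level (C U : set T) N : compact C -> open U -> C `<=` U ->
  exists2 n, (N <= n)%N & forall x, C x -> c n x `<=` U.
Proof.
move=> cC oU CU.
have [n hn] : exists n, C `<=` [set x | c (N + n)%N x `<=` U].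
  apply: compact_increasing => //.
  - move=> n; rewrite openE => x /= cxU.
    apply: (@filterS _ _ _ (c (N + n)%N x)).
      by move=> y cxy /=; rewrite (cs_eq cs cxy).
    by apply: open_nbhs_nbhs; split; [exact: cs_open|exact: cs_refl].
  - move=> n x /= ; apply: subset_trans; apply: cs_homo; rewrite leq_add2l.
    exact: leqnSn.
  - move=> x /CU Ux; have [n h] := cs_basis cs oU Ux.
    by exists n; apply: subset_trans h; apply: cs_homo; rewrite leq_addl.
by exists (N + n)%N => //; exact: leq_addr.
Qed.

End coset_systems.

Definition rcoset (G : groupType) (A : set G) (g : G) : set G :=
  [set (x * g)%g | x in A].

Section translates.
Variable G : groupType.
Implicit Types (A B : set G) (g h x : G).

Lemma lcosetP g A x : lcoset g A x <-> A (g^-1 * x)%g.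
Proof.
split=> [[y Ay <-]|Ax]; first by rewrite mulKg.
by exists (g^-1 * x)%g => //; rewrite mulVKg.
Qed.

Lemma rcosetP A g x : rcoset A g x <-> A (x * g^-1)%g.
Proof.
split=> [[y Ay <-]|Ax]; first by rewrite mulgK.
by exists (x * g^-1)%g => //; rewrite mulgVK.
Qed.

Lemma lcosetM g h A : lcoset (g * h)%g A = lcoset g (lcoset h A).
Proof.
by apply/seteqP; split=> x; rewrite !lcosetP invgM mulgA.
Qed.

Lemma rcosetM A g h : rcoset A (g * h)%g = rcoset (rcoset A g) h.
Proof. by apply/seteqP; split=> x; rewrite !rcosetP invgM mulgA. Qed.

Lemma lcoset1 A : lcoset 1%g A = A.
Proof. by apply/seteqP; split=> x; rewrite !lcosetP invg1 mul1g. Qed.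

Lemma rcoset1 A : rcoset A 1%g = A.
Proof. by apply/seteqP; split=> x; rewrite !rcosetP invg1 mulg1. Qed.

Lemma lrcoset A g h : rcoset (lcoset g A) h = lcoset g (rcoset A h).
Proof. by apply/seteqP; split=> x; rewrite !(rcosetP, lcosetP) mulgA. Qed.

Lemma conjsetE h A : conjset h A = lcoset h (rcoset A h^-1).
Proof.
apply/seteqP; split=> x; rewrite !(rcosetP, lcosetP).
  by move=> [y Ay <-]; rewrite invgK -!mulgA mulKg mulVg mulg1.
rewrite invgK => Ax; exists (h^-1 * x * h)%g => //.
by rewrite mulgA mulVKg mulgK.
Qed.

End translates.

(** Subgroups as plain sets, so that intersections with a subgroup and the
    subgroups of [G] are treated alike. *)
Definition subgroup_set (G : groupType) (K : set G) :=
  K 1%g /\ forall x y, K x -> K y -> K (x^-1 * y)%g.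

Section subgroup_sets.
Variables (G : groupType) (K : set G).
Hypothesis sgK : subgroup_set K.

Lemma sg1 : K 1%g. Proof. by case: sgK. Qed.
Lemma sgV x : K x -> K x^-1%g.
Proof. by move=> Kx; rewrite -[_^-1%g]mulg1; apply: sgK.2 => //; exact: sg1. Qed.
Lemma sgM x y : K x -> K y -> K (x * y)%g.
Proof. by move=> Kx Ky; rewrite -[x]invgK; apply: sgK.2 => //; exact: sgV. Qed.

Lemma sg_lcoset x : K x -> lcoset x K = K.
Proof.
move=> Kx; apply/seteqP; split=> y; rewrite lcosetP => h; last first.
  by apply: sgM => //; exact: sgV.
by rewrite -(mulVKg x y); exact: sgM.
Qed.

Lemma sg_rcoset x : K x -> rcoset K x = K.
Proof.
move=> Kx; apply/seteqP; split=> y; rewrite rcosetP => h; last first.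
  by apply: sgM => //; exact: sgV.
by rewrite -(mulgVK x y); exact: sgM.
Qed.

Lemma lcoset_eq x y : lcoset x K y -> lcoset y K = lcoset x K.
Proof.
by move=> /lcosetP h; rewrite -(mulVKg x y) lcosetM (sg_lcoset h).
Qed.

Lemma rcoset_eq x y : rcoset K x y -> rcoset K y = rcoset K x.
Proof.
by move=> /rcosetP h; rewrite -(mulgVK x y) rcosetM (sg_rcoset h).
Qed.

End subgroup_sets.

Record compact_open_basis (G : topologicalGroupType) (K : nat -> set G) : Prop := {
  cob_subgroup : forall n, subgroup_set (K n);
  cob_compact : forall n, compact (K n);
  cob_open : forall n, open (K n);
  cob_basis : nbhs_basis1 K
}.

Section topological_translates.
Variable G : topologicalGroupType.
Implicit Types (A U : set G) (g : G).

Lemma continuous_mulgl g : continuous (fun x : G => (g * x)%g).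
Proof.
move=> x; apply: (@continuous2_cvg _ G G G _ _ (fun=> g) id (fun x y => (x * y)%g)).
- exact: (@mulg_continuous G (g, x)).
- exact: cvg_cst.
- exact: cvg_id.
Qed.

Lemma continuous_mulgr g : continuous (fun x : G => (x * g)%g).
Proof.
move=> x; apply: (@continuous2_cvg _ G G G _ _ id (fun=> g) (fun x y => (x * y)%g)).
- exact: (@mulg_continuous G (x, g)).
- exact: cvg_id.
- exact: cvg_cst.
Qed.

Lemma open_lcoset g U : open U -> open (lcoset g U).
Proof.
move=> oU; suff -> : lcoset g U = (fun x => g^-1 * x)%g @^-1` U.
  by apply: open_comp => // x _; exact: continuous_mulgl.
by apply/seteqP; split=> x; rewrite lcosetP.
Qed.

Lemma open_rcoset g U : open U -> open (rcoset U g).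
Proof.
move=> oU; suff -> : rcoset U g = (fun x => x * g^-1)%g @^-1` U.
  by apply: open_comp => // x _; exact: continuous_mulgr.
by apply/seteqP; split=> x; rewrite rcosetP.
Qed.

Lemma compact_lcoset g A : compact A -> compact (lcoset g A).
Proof.
apply: continuous_compact; apply: continuous_subspaceT.
exact: continuous_mulgl.
Qed.

Lemma compact_rcoset g A : compact A -> compact (rcoset A g).
Proof.
apply: continuous_compact; apply: continuous_subspaceT.
exact: continuous_mulgr.
Qed.

Variable K : nat -> set G.
Hypothesis cobK : compact_open_basis K.

Lemma lcoset_system : coset_system (fun n x => lcoset x (K n)).
Proof.
split.
- by move=> n x; apply: open_lcoset; exact: cob_open.
- by move=> n x; rewrite lcosetP mulVg; apply: sg1; exact: cob_subgroup.
- by move=> n x y; apply: lcoset_eq; exact: cob_subgroup.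
- by move=> n x y; rewrite !lcosetP; exact: (cob_basis cobK).2.1.
- move=> U x oU Ux.
  have : nbhs (1%g : G) (lcoset x^-1 U).
    by apply: open_nbhs_nbhs; split; [exact: open_lcoset|rewrite lcosetP invgK mulg1].
  move=> /(cob_basis cobK).2.2[n h]; exists n => y; rewrite lcosetP => /h.
  by rewrite lcosetP invgK mulVKg.
Qed.

Lemma rcoset_system : coset_system (fun n x => rcoset (K n) x).
Proof.
split.
- by move=> n x; apply: open_rcoset; exact: cob_open.
- by move=> n x; rewrite rcosetP mulgV; apply: sg1; exact: cob_subgroup.
- by move=> n x y; apply: rcoset_eq; exact: cob_subgroup.
- by move=> n x y; rewrite !rcosetP; exact: (cob_basis cobK).2.1.
- move=> U x oU Ux.
  have : nbhs (1%g : G) (rcoset U x^-1).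
    by apply: open_nbhs_nbhs; split; [exact: open_rcoset|rewrite rcosetP invgK mul1g].
  move=> /(cob_basis cobK).2.2[n h]; exists n => y; rewrite rcosetP => /h.
  by rewrite rcosetP invgK mulgVK.
Qed.

Lemma cob_homo m n : (m <= n)%N -> K n `<=` K m.
Proof.
by move=> mn; rewrite -[K n]lcoset1 -[K m]lcoset1; exact: (cs_homo lcoset_system).
Qed.

End topological_translates.

(** * Indicators of sets of finite measure *)

Record partition_by (T : Type) (I : eqType) (A : set T) (s : seq I) (B : I -> set T)
  : Prop := PartitionBy {
  part_uniq : uniq s;
  part_mem : forall z, A z <-> exists2 i, i \in s & B i z;
  part_disj : {in s &, forall i j z, B i z -> B j z -> i = j}
}.

Lemma partition_nil (T : Type) (I : eqType) (A : set T) (B : I -> set T) :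
  partition_by A [::] B -> A = set0.
Proof. by move=> p; apply/seteqP; split=> z // /(part_mem p)[]. Qed.

Lemma partition_cons (T : Type) (I : eqType) (A : set T) a (s : seq I)
    (B : I -> set T) : partition_by A (a :: s) B ->
  [/\ A = B a `|` (A `\` B a), partition_by (A `\` B a) s B & B a `<=` A].
Proof.
move=> [/= /andP[an us] mem dj].
have Ba : B a `<=` A by move=> z Bz; apply/mem; exists a => //; exact: mem_head.
split=> //; first by rewrite setDUK.
split=> // [z|x y xs ys]; last by apply: dj; rewrite inE ?xs ?ys orbT.
split=> [[/mem[i + Bi nB]]|[i si Bi]].
  by rewrite inE => /predU1P[ia|]; [move: nB; rewrite -ia|exists i].
split; first by apply/mem; exists i => //; rewrite inE si orbT.
move=> Baz; have ia : i = a by apply: (dj i a _ _ z) => //; rewrite inE ?eqxx ?si ?orbT.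
by move: an; rewrite -ia si.
Qed.

Lemma coset_partition (T : topologicalType) (c : nat -> T -> set T) n (A : set T) :
  coset_system c -> compact A -> (forall x, A x -> c n x `<=` A) ->
  exists2 s : seq T, partition_by A s (c n) & forall x, x \in s -> A x.
Proof.
move=> cs cA inA; have [s [us sA sep scov]] := compact_cosets cs n cA.
exists s => //; split=> // [z|x y xs ys z cx cy].
  split; first exact: scov.
  by move=> [x /sA Ax]; exact: inA.
apply: sep => //; rewrite -(cs_eq cs cx) (cs_eq cs cy); exact: cs_refl.
Qed.

Section indicator_class.
Context d (T : measurableType d) (R : realType).
Variable mu : {measure set T -> \bar R}.
Implicit Types A B : set T.

Definition fin_meas A := measurable A /\ (mu A < +oo)%E.

Lemma fin_meas0 : fin_meas set0.
Proof. by split=> //; rewrite measure0 ltry. Qed.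

Lemma fin_measS A B : measurable A -> A `<=` B -> fin_meas B -> fin_meas A.
Proof.
move=> mA AB [mB fB]; split=> //; apply: le_lt_trans fB.
by apply: le_measure => //; rewrite inE.
Qed.

Lemma fin_measU A B : fin_meas A -> fin_meas B -> fin_meas (A `|` B).
Proof.
move=> [mA fA] [mB fB]; split; first exact: measurableU.
exact: le_lt_trans (measureU2 mu mA mB) (lte_add_pinfty fA fB).
Qed.

Lemma fin_measD A B : fin_meas A -> fin_meas B -> fin_meas (A `\` B).
Proof.
move=> fA fB; apply: (fin_measS _ (@subDsetl _ A B) fA).
by apply: measurableD; [case: fA|case: fB].
Qed.

Lemma fin_measE A : fin_meas A -> mu A = (fine (mu A))%:E.
Proof. by move=> [_ fA]; rewrite fineK// ge0_fin_numE. Qed.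

Definition vol A : R := fine (mu A).

Lemma volU A B : fin_meas A -> fin_meas B -> A `&` B = set0 ->
  vol (A `|` B) = vol A + vol B.
Proof.
move=> fA fB AB; rewrite /vol measureU//; [|by case: fA|by case: fB].
by rewrite fineD ?ge0_fin_numE ?(fA.2, fB.2).
Qed.

Lemma vol_ge0 A : 0 <= vol A.
Proof. by rewrite fine_ge0. Qed.

Lemma vol_le A B : fin_meas A -> fin_meas B -> A `<=` B -> vol A <= vol B.
Proof.
move=> fA fB AB; rewrite -lee_fin -(fin_measE fA) -(fin_measE fB).
by apply: le_measure => //; rewrite inE; [case: fA|case: fB].
Qed.

Lemma additive_partition (V : nmodType) (phi : set T -> V) (I : eqType)
    (s : seq I) (B : I -> set T) A : phi set0 = 0 ->
    (forall C D, fin_meas C -> fin_meas D -> C `&` D = set0 ->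
       phi (C `|` D) = phi C + phi D) ->
    fin_meas A -> (forall i, i \in s -> measurable (B i)) ->
    partition_by A s B ->
  phi A = \sum_(i <- s) phi (B i).
Proof.
move=> phi0 phiD; elim: s A => [|a s IH] A fA mB p.
  by rewrite big_nil (partition_nil p).
have [AE p' BaA] := partition_cons p.
have fBa : fin_meas (B a) by apply: (fin_measS _ BaA fA); apply: mB; exact: mem_head.
have fD := fin_measD fA fBa.
rewrite big_cons {1}AE phiD//; last by rewrite setDIK.
by rewrite (IH _ fD)// => i si; apply: mB; rewrite inE si orbT.
Qed.

Lemma vol0 : vol set0 = 0. Proof. by rewrite /vol measure0. Qed.

Definition indC A : T -> R[i] := realC (\1_A : T -> R).

Lemma indC_sqint A : fin_meas A -> indC A \in sqint mu.
Proof.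
move=> [mA fA]; apply/realC_sqint/Lfun2P; first exact: measurable_indic.
rewrite (eq_integral (fun x => (\1_A x)%:E)) => [|x _]; last first.
  by rewrite indicE; case: (x \in A); rewrite ?expr1n ?expr0n.
by rewrite integral_indic// setIT.
Qed.

Definition ind A : L2 mu := L2_of mu (indC A).

Lemma ind0 : ind set0 = 0.
Proof.
by rewrite -(L2_of0 mu); congr L2_of; apply/funext => x; rewrite /indC /realC indic0.
Qed.

Lemma indU A B : fin_meas A -> fin_meas B -> A `&` B = set0 ->
  ind (A `|` B) = ind A + ind B.
Proof.
move=> fA fB AB; rewrite -L2_ofD ?indC_sqint//; congr L2_of; apply/funext => x.
rewrite /indC /realC /= -rmorphD; congr (_%:C%C); rewrite !indicE in_setU.
have [Ax|nA] := boolP (x \in A); have [Bx|nB] := boolP (x \in B);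
  rewrite /= ?addr0 ?add0r//.
by have : (A `&` B) x; [by split; exact: set_mem|rewrite AB].
Qed.

Lemma ip_ind A B : fin_meas A -> fin_meas B -> ip (ind A) (ind B) = vol (A `&` B).
Proof.
move=> fA fB; rewrite ip_L2_of ?indC_sqint//.
transitivity (\int[mu]_x (\1_(A `&` B) x : R)).
  apply: eq_Rintegral => x _; rewrite /ip_fun /indC /realC /= mulr0 addr0.
  by rewrite -[\1_A]/(_ : T -> R) indicI.
rewrite /Rintegral integral_indic ?setIT//.
by apply: measurableI; [case: fA|case: fB].
Qed.

Lemma ip_i_ind A B : fin_meas A -> fin_meas B -> ip ('i%C *: ind A) (ind B) = 0.
Proof.
move=> fA fB; rewrite -L2_ofZ ?indC_sqint// ip_L2_of; last 2 first.
- exact: (rpredZ 'i%C (indC_sqint fA)).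
- exact: indC_sqint.
transitivity (\int[mu]_x (0 : R)).
  apply: eq_Rintegral => x _.
  by rewrite /ip_fun /indC /realC /= !(mul0r, mulr0, subr0, addr0).
by rewrite /Rintegral integral0.
Qed.

Lemma ind_partition (I : eqType) (s : seq I) (B : I -> set T) A :
    fin_meas A -> (forall i, i \in s -> measurable (B i)) ->
    partition_by A s B -> ind A = \sum_(i <- s) ind (B i).
Proof. by move=> fA mB p; apply: additive_partition p => //; [exact: ind0|exact: indU]. Qed.

Lemma vol_partition (I : eqType) (s : seq I) (B : I -> set T) A :
    fin_meas A -> (forall i, i \in s -> measurable (B i)) ->
    partition_by A s B -> vol A = \sum_(i <- s) vol (B i).
Proof. by move=> fA mB p; apply: additive_partition p => //; [exact: vol0|exact: volU]. Qed.

Lemma ip_ind_partition (I : eqType) (s : seq I) (B : I -> set T) A xi :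
    fin_meas A -> (forall i, i \in s -> measurable (B i)) ->
    partition_by A s B -> ip xi (ind A) = \sum_(i <- s) ip xi (ind (B i)).
Proof. by move=> fA mB p; rewrite (ind_partition fA mB p) ip_sumr. Qed.

End indicator_class.

(** * Density of indicators *)

Import HBNNSimple.

Section density.
Context d (T : measurableType d) (R : realType).
Variable mu : {measure set T -> \bar R}.

(** Sequential closedness is phrased by approximation in the squared norm, the
    form in which it is both checked and used. *)
Record closed_subspace (P : L2 mu -> Prop) : Prop := {
  csub_add : forall xi eta, P xi -> P eta -> P (xi + eta);
  csub_scale : forall z xi, P xi -> P (z *: xi);
  csub_lim : forall xi,
    (forall eps : R, 0 < eps -> exists2 eta, P eta & ip (xi - eta) (xi - eta) <= eps) ->
    P xi
}.

Variable P : L2 mu -> Prop.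
Hypothesis cP : closed_subspace P.
Hypothesis Pe : forall A, fin_meas mu A -> P (ind mu A).

(** The value [0] is excluded because its level set may have infinite measure;
    it contributes nothing to the sum. *)
Lemma dense_simple (s : seq R) (A : R -> set T) :
  (forall y, y != 0 -> fin_meas mu (A y)) ->
  realC (fun x => \sum_(y <- s) (y * \1_(A y) x)) \in sqint mu /\
  P (L2_of mu (realC (fun x => \sum_(y <- s) (y * \1_(A y) x)))).
Proof.
move=> fA; elim: s => [|a s [Ls Ps]].
  under [X in realC X]eq_fun do rewrite big_nil.
  have -> : realC (fun=> 0) = (fun=> 0) :> (T -> R[i]) by apply/funext.
  split; first exact: rpred0.
  by rewrite L2_of0 -(ind0 mu); apply: Pe; exact: fin_meas0.
under [X in realC X]eq_fun do rewrite big_cons.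
have [->|a0] := eqVneq a 0.
  by under [X in realC X]eq_fun do rewrite mul0r add0r.
have LA := indC_sqint (fA _ a0).
have -> : realC (fun x => a * \1_(A a) x + \sum_(y <- s) y * \1_(A y) x) =
    (fun x => a%:C%C * indC R (A a) x) \+ realC (fun x => \sum_(y <- s) y * \1_(A y) x).
  by apply/funext => x; rewrite /realC /indC rmorphD rmorphM.
have LZ : (fun x => a%:C%C * indC R (A a) x) \in sqint mu by exact: (rpredZ a%:C%C LA).
split; first exact: rpredD.
rewrite L2_ofD// L2_ofZ//; apply: (csub_add cP) => //.
by apply: (csub_scale cP); apply: Pe; exact: fA.
Qed.

(** Approximation from below by simple functions, with convergence in mean
    square by domination by [g ^+ 2]. *)
Lemma dense_nneg (g : T -> R) : g \in Lfun mu 2%:E -> (forall x, 0 <= g x) ->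
  P (L2_of mu (realC g)).
Proof.
move=> Lg g0; have mg := Lfun2_measurable Lg.
have mEg : measurable_fun setT (EFin \o g) by exact/measurable_EFinP.
have g0' x : [set: T] x -> (0 <= (EFin \o g) x)%E by move=> _; rewrite lee_fin.
pose gn := nnsfun_approx measurableT mEg.
have gn_le n x : gn n x <= g x.
  by rewrite -lee_fin /gn nnsfun_approxE; exact: (le_approx n g0' (I : setT x)).
have gn0 n x : 0 <= gn n x by [].
have Lgn n : (gn n : T -> R) \in Lfun mu 2%:E.
  by apply: (Lfun2_le Lg) => // x; rewrite ler_pXn2r ?nnegrE.
have Pgn n : P (L2_of mu (realC (gn n))).
  have fA (y : R) : y != 0 -> fin_meas mu (gn n @^-1` [set y]).
    move=> y0; have mA : measurable (gn n @^-1` [set y]) by [].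
    split=> //.
    rewrite -[_ @^-1` _]setIT -integral_indic//.
    (* Markov's inequality: the indicator is at most [(gn n / y) ^+ 2]. *)
    have iZ : mu.-integrable setT (fun x => ((y ^- 2) * (gn n x ^+ 2))%:E).
      exact: (integrableZl measurableT (y ^- 2) (Lfun2_integrable_sqr (Lgn n))).
    have /integrableP[_] := iZ; apply: le_lt_trans.
    apply: ge0_le_integral => //=.
    - by apply/measurable_EFinP; apply: measurable_indic; exact: mA.
    - apply/measurable_EFinP; apply: measurableT_comp => //.
      by apply/measurable_EFinP; case/integrableP: iZ.
    - move=> x _; rewrite lee_fin indicE.
      have [/set_mem /= ->|_] := boolP (x \in gn n @^-1` [set y]); last by rewrite normr_ge0.
      by rewrite mulVf ?normr1// expf_neq0.
  have -> : (gn n : T -> R) = (fun x => \sum_(y <- finmap.enum_fset (fset_set (range (gn n))))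
      (y * \1_(gn n @^-1` [set y]) x)).
    by apply/funext => x; rewrite {1}fimfunE fsbig_finite.
  exact: (dense_simple _ _).2.
apply: (csub_lim cP) => eps eps0.
have [//|||||_ _ +] := @dominated_convergence _ _ _ mu setT measurableT
  (fun n x => ((g x - gn n x) ^+ 2)%:E) (cst 0%E) (fun x => (g x ^+ 2)%:E).
- by move=> n; apply/measurable_EFinP/measurable_funX; exact: measurable_funB.
- exact: measurable_cst.
- apply: aeW => x _; rewrite [X in _ --> X](_ : _ = ((g x - g x) ^+ 2)%:E); last first.
    by rewrite subrr expr0n.
  apply: cvg_EFin; first by near=> n.
  have c : gn ^~ x @ \oo --> g x.
    by have /fine_cvgP[_] := cvg_nnsfun_approx measurableT mEg g0' (I : setT x).
  rewrite /comp /=; under eq_fun do rewrite expr2; rewrite expr2.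
  by apply: cvgM; (apply: cvgB; [exact: cvg_cst|exact: c]).
- exact: Lfun2_integrable_sqr.
- apply: aeW => x n _; rewrite /= lee_fin ger0_norm ?sqr_ge0//.
  by rewrite ler_pXn2r ?nnegrE ?subr_ge0// gerBl.
rewrite integral_cst// mul0e => /fine_cvgP[_ /cvgrPdist_lt/(_ _ eps0)] [N _ hN].
have small := hN N (leqnn N).
exists (L2_of mu (realC (gn N))) => //.
have Ld : (g \- gn N : T -> R) \in Lfun mu 2%:E.
  apply: (Lfun2_le Lg); first exact: measurable_funB.
  by move=> x; rewrite /= ler_pXn2r ?nnegrE ?subr_ge0// gerBl.
have -> : L2_of mu (realC g) - L2_of mu (realC (gn N)) = L2_of mu (realC (g \- gn N)).
  apply/eqP; rewrite subr_eq -L2_ofD ?realC_sqint//.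
  apply/eqP; congr L2_of; apply/funext => x.
  by rewrite /realC /= -rmorphD subrK.
rewrite ip_L2_of ?realC_sqint//; move: small => /=; rewrite sub0r normrN => /ltW.
apply: le_trans; apply: le_trans (ler_norm _).
rewrite /Rintegral le_eqVlt; apply/orP; left; apply/eqP; congr fine.
by apply: eq_integral => x _; rewrite /ip_fun /realC /= mulr0 addr0 expr2.
Unshelve. all: end_near. Qed.

Lemma dense_L2 xi : P xi.
Proof.
have PB xi1 xi2 : P xi1 -> P xi2 -> P (xi1 - xi2).
  move=> P1 P2; rewrite -scaleN1r; apply: (csub_add cP) => //.
  exact: (csub_scale cP).
have dense_real (h : T -> R) : h \in Lfun mu 2%:E -> P (L2_of mu (realC h)).
  move=> Lh; have mh := Lfun2_measurable Lh.
  have Lp : (fun x => Num.max (h x) 0) \in Lfun mu 2%:E.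
    apply: (Lfun2_le Lh); first exact: measurable_maxr.
    move=> x; case: (leP (h x) 0) => hx //; first by rewrite expr0n sqr_ge0.
  have Lm : (fun x => Num.max (- h x) 0) \in Lfun mu 2%:E.
    apply: (Lfun2_le Lh).
      by apply: measurable_maxr => //; exact: measurableT_comp.
    move=> x; case: (leP (- h x) 0) => hx; rewrite ?sqrrN// expr0n sqr_ge0//.
  have -> : L2_of mu (realC h) = L2_of mu (realC (fun x => Num.max (h x) 0)) -
      L2_of mu (realC (fun x => Num.max (- h x) 0)).
    apply/eqP; rewrite eq_sym subr_eq -L2_ofD ?realC_sqint//; apply/eqP; congr L2_of.
    apply/funext => x; rewrite /realC /= -rmorphD; congr (_%:C%C).
    by case: (leP (h x) 0) => hx; case: (leP (- h x) 0) => hx'; lra.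
  by apply: PB; apply: dense_nneg => // x; rewrite le_max lexx orbT.
elim/L2_ind: xi => f; rewrite -L2_of_val.
have /andP[Lr Li] : val f \in sqint mu by exact: valP.
have -> : val f = realC (complex.Re (R:=R) \o val f) \+
    (fun x => 'i%C * realC (complex.Im (R:=R) \o val f) x).
  by apply/funext => x; rewrite /realC /= [LHS]complexE.
rewrite L2_ofD ?realC_sqint//; last by apply: (rpredZ 'i%C (realC_sqint Li)).
rewrite L2_ofZ ?realC_sqint//; apply: (csub_add cP); first exact: dense_real.
by apply: (csub_scale cP); exact: dense_real.
Qed.

End density.

(** * Translation operators *)

(** Left and right translations are both composition with a measurable map that
    multiplies the measure by a constant, so they are treated at once. *)
Section composition_operator.
Context d (T : measurableType d) (R : realType).
Variable mu : {measure set T -> \bar R}.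
Variables (phi : T -> T) (c : R).
Hypothesis mphi : measurable_fun setT phi.
Hypothesis c0 : 0 <= c.
Hypothesis muphi : forall A, measurable A -> mu (phi @^-1` A) = (c%:E * mu A)%E.

Lemma integral_comp_scale (F : T -> \bar R) : measurable_fun setT F ->
  (forall x, 0 <= F x)%E -> (\int[mu]_x F (phi x) = c%:E * \int[mu]_x F x)%E.
Proof.
move=> mF F0.
have := @ge0_integral_pushforward _ _ _ _ _ phi mphi mu setT F measurableT mF
  (fun x _ => F0 x).
rewrite preimage_setT => <-.
rewrite -(@ge0_integral_mscale _ _ _ mu setT measurableT (NngNum c0))//.
by apply: eq_measure_integral => A mA _; rewrite /mscale /=; exact: muphi.
Qed.

Lemma Lfun2_comp (h : T -> R) : h \in Lfun mu 2%:E -> h \o phi \in Lfun mu 2%:E.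
Proof.
move=> Lh; have mh := Lfun2_measurable Lh.
apply: Lfun2P; first exact: measurableT_comp.
rewrite (@integral_comp_scale (fun x => (h x ^+ 2)%:E)); last 2 first.
- by apply/measurable_EFinP; exact: measurable_funX.
- by move=> x; rewrite lee_fin sqr_ge0.
have := integrable_fin_num measurableT (Lfun2_integrable_sqr Lh).
by move=> fin; rewrite -(fineK fin) -EFinM ltry.
Qed.

Lemma sqint_comp f : f \in sqint mu -> f \o phi \in sqint mu.
Proof.
by move=> /andP[fr fi]; apply/andP; split; [exact: (Lfun2_comp fr)|exact: (Lfun2_comp fi)].
Qed.

Definition comp_op (xi : L2 mu) : L2 mu := L2_of mu (val (repr xi) \o phi).

Lemma comp_opE (f : sqintType mu) : comp_op (L2_class f) = L2_of mu (val f \o phi).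
Proof.
rewrite /comp_op (L2_ofE (sqint_comp (valP _))) (L2_ofE (sqint_comp (valP _))).
apply/eqP/L2_classP => /=.
have [N [mN N0 sN]] := L2_repr_class f.
exists (phi @^-1` N); split.
- by rewrite -[_ @^-1` _]setTI; exact: mphi.
- by rewrite muphi// N0 mule0.
- by move=> x fx /=; apply: sN => fgx; apply: fx => _; exact: fgx.
Qed.

Lemma comp_op_L2_of f : f \in sqint mu -> comp_op (L2_of mu f) = L2_of mu (f \o phi).
Proof. by move=> Lf; rewrite {1}(L2_ofE Lf) comp_opE. Qed.

Lemma comp_opD : {morph comp_op : xi eta / xi + eta}.
Proof.
elim/L2_ind => f; elim/L2_ind => g; rewrite -L2_classD !comp_opE -L2_ofD//;
  exact: (sqint_comp (valP _)).
Qed.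

Lemma comp_opZ z xi : comp_op (z *: xi) = z *: comp_op xi.
Proof.
elim/L2_ind: xi => f; rewrite -[z *: L2_class f]/(L2_scale _ _) L2_scaleE !comp_opE.
by rewrite -L2_ofZ//; exact: (sqint_comp (valP _)).
Qed.

Lemma comp_op_linear : linear comp_op.
Proof. by move=> a xi eta; rewrite comp_opD comp_opZ. Qed.

Lemma comp_op_ip_self xi : ip (comp_op xi) (comp_op xi) = c * ip xi xi.
Proof.
elim/L2_ind: xi => f; rewrite comp_opE -L2_of_val.
have Lf : val f \in sqint mu by exact: valP.
rewrite !ip_L2_of ?sqint_comp//.
have := integral_comp_scale (ip_fun_measurable Lf Lf).
rewrite /Rintegral => ->; last first.
  by move=> x; rewrite lee_fin /ip_fun -!expr2 addr_ge0// sqr_ge0.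
have := integrable_fin_num measurableT (ip_fun_integrable Lf Lf).
by rewrite /comp => fin; rewrite /comp fineM.
Qed.

(** From the case of equal arguments by polarization. *)
Lemma comp_op_ip xi eta : ip (comp_op xi) (comp_op eta) = c * ip xi eta.
Proof.
have h (a b : L2 mu) : ip a b = (ip (a + b) (a + b) - ip a a - ip b b) / 2.
  by rewrite !(ipDl, ipDr) (ipC b a); lra.
by rewrite (h (comp_op xi)) (h xi) -comp_opD !comp_op_ip_self; lra.
Qed.

Lemma comp_op_bounded : bounded_op comp_op.
Proof.
apply: (@ip_bounded_op _ _ _ _ _ c); first exact: comp_op_linear.
by move=> xi; rewrite comp_op_ip_self.
Qed.

Lemma comp_op_ind A : fin_meas mu A -> comp_op (ind mu A) = ind mu (phi @^-1` A).
Proof. by move=> fA; rewrite comp_op_L2_of// indC_sqint. Qed.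

Lemma fin_meas_preimage A : fin_meas mu A -> fin_meas mu (phi @^-1` A).
Proof.
move=> fA; have [mA _] := fA; split.
  by rewrite -[_ @^-1` _]setTI; exact: mphi.
by rewrite muphi// (fin_measE fA) -EFinM ltry.
Qed.

Lemma vol_preimage A : fin_meas mu A -> vol mu (phi @^-1` A) = c * vol mu A.
Proof.
move=> fA; have [mA oA] := fA; rewrite /vol muphi// fineM//.
by rewrite ge0_fin_numE.
Qed.

End composition_operator.

Section haar_translations.
Variables (R : realType) (G : topologicalGroupType).
Variable mu : {measure set (borel G) -> \bar R}.
Hypothesis hmu : left_haar mu.
Implicit Types (A B U C : set G) (g h : G).

Lemma open_measurable U : open U -> measurable (U : set (borel G)).
Proof. exact: sub_sigma_algebra. Qed.

Lemma compact_measurable (G_hausdorff : hausdorff_space G) C :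
  compact C -> measurable (C : set (borel G)).
Proof.
move=> cC; rewrite -(setCK C); apply: measurableC; apply: open_measurable.
by apply: closed_openC; exact: compact_closed.
Qed.

Lemma measurable_mulgr (g : G) :
  measurable_fun setT ((fun x : G => (x * g)%g) : borel G -> borel G).
Proof.
apply: (@measurability _ _ (borel G) (borel G) setT _ (@open G)) => // _ [U oU <-].
rewrite setTI; apply: open_measurable.
by apply: (@open_comp G G) oU => x _; exact: continuous_mulgr.
Qed.

Lemma lcoset_preimage g A : lcoset g A = (fun x : G => (g^-1 * x)%g) @^-1` A.
Proof. by apply/seteqP; split=> x; rewrite lcosetP. Qed.

Lemma rcoset_preimage g A : rcoset A g = (fun x : G => (x * g^-1)%g) @^-1` A.
Proof. by apply/seteqP; split=> x; rewrite rcosetP. Qed.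

Lemma measurable_rcoset g A : measurable (A : set (borel G)) ->
  measurable (rcoset A g : set (borel G)).
Proof.
by move=> mA; rewrite rcoset_preimage -[_ @^-1` _]setTI; exact: measurable_mulgr.
Qed.

Let phil g : borel G -> borel G := fun x : G => (g^-1 * x)%g.

Let muphil g (A : set (borel G)) : measurable A ->
  mu (phil g @^-1` A) = (1%:E * mu A)%E.
Proof.
move=> mA; rewrite mul1e -(haar_left hmu g mA); congr (mu _).
by rewrite -/(lcoset g (A : set G)) lcoset_preimage.
Qed.

Definition ltrans_op g : L2 mu -> L2 mu := comp_op (phil g).

Lemma left_regular_ltrans_op g : left_regular hmu g = ltrans_op g.
Proof.
apply/funext => xi; rewrite /ltrans_op /comp_op (L2_ofE (ltrans_sqint hmu g (repr xi))).
by congr L2_class; exact: val_inj.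
Qed.

Lemma ltrans_op_linear g : linear (ltrans_op g).
Proof. exact: (comp_op_linear (@measurable_mulgl G (g^-1)%g) ler01 (@muphil g)). Qed.
Lemma ltrans_op_bounded g : bounded_op (ltrans_op g).
Proof. exact: (comp_op_bounded (@measurable_mulgl G (g^-1)%g) ler01 (@muphil g)). Qed.
Lemma ltrans_op_ip g xi eta : ip (ltrans_op g xi) (ltrans_op g eta) = ip xi eta.
Proof.
by rewrite (comp_op_ip (@measurable_mulgl G (g^-1)%g) ler01 (@muphil g)) mul1r.
Qed.
Lemma ltrans_op_ind g A : fin_meas mu A -> ltrans_op g (ind mu A) = ind mu (lcoset g A).
Proof.
move=> fA; rewrite lcoset_preimage.
exact: (comp_op_ind (@measurable_mulgl G (g^-1)%g) ler01 (@muphil g)).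
Qed.
Lemma fin_meas_lcoset g A : fin_meas mu A -> fin_meas mu (lcoset g A).
Proof.
move=> fA; rewrite lcoset_preimage.
exact: (fin_meas_preimage (@measurable_mulgl G (g^-1)%g) (@muphil g)).
Qed.
Lemma vol_lcoset g A : fin_meas mu A -> vol mu (lcoset g A) = vol mu A.
Proof. by move=> fA; rewrite lcoset_preimage (vol_preimage (@muphil g))// mul1r. Qed.

Section right.
Variable Delta : G -> R.
Hypothesis Delta_modular : modular_function mu Delta.

Let phir g : borel G -> borel G := fun x : G => (x * g)%g.

Let muphir g (A : set (borel G)) : measurable A ->
  mu (phir g @^-1` A) = ((Delta (g^-1)%g)%:E * mu A)%E.
Proof.
move=> mA; rewrite -((Delta_modular (g^-1)%g).2 _ mA); congr (mu _).
by rewrite -/(rcoset (A : set G) (g^-1)%g) rcoset_preimage invgK.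
Qed.

Let D0 g : 0 <= Delta (g^-1)%g. Proof. by rewrite ltW// (Delta_modular (g^-1)%g).1. Qed.

Definition rtrans_op g : L2 mu -> L2 mu := comp_op (phir g).

Lemma rtrans_op_linear g : linear (rtrans_op g).
Proof. exact: (comp_op_linear (@measurable_mulgr g) (D0 g) (@muphir g)). Qed.
Lemma rtrans_op_bounded g : bounded_op (rtrans_op g).
Proof. exact: (comp_op_bounded (@measurable_mulgr g) (D0 g) (@muphir g)). Qed.
Lemma rtrans_op_ip g xi eta : ip (rtrans_op g xi) (rtrans_op g eta) = Delta (g^-1)%g * ip xi eta.
Proof. exact: (comp_op_ip (@measurable_mulgr g) (D0 g) (@muphir g) _ _). Qed.
Lemma rtrans_op_ind g A : fin_meas mu A -> rtrans_op g (ind mu A) = ind mu (rcoset A (g^-1)%g).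
Proof.
move=> fA; rewrite rcoset_preimage invgK.
exact: (comp_op_ind (@measurable_mulgr g) (D0 g) (@muphir g)).
Qed.
Lemma fin_meas_rcoset g A : fin_meas mu A -> fin_meas mu (rcoset A g).
Proof.
move=> fA; rewrite rcoset_preimage.
exact: (fin_meas_preimage (@measurable_mulgr (g^-1)%g) (@muphir (g^-1)%g)).
Qed.
Lemma vol_rcoset g A : fin_meas mu A -> vol mu (rcoset A g) = Delta g * vol mu A.
Proof.
by move=> fA; rewrite rcoset_preimage (vol_preimage (@muphir (g^-1)%g))// invgK.
Qed.

Lemma ltrans_rtrans_op g h : ltrans_op g \o rtrans_op h = rtrans_op h \o ltrans_op g.
Proof.
apply/funext; elim/L2_ind => f.
have Lr := sqint_comp (@measurable_mulgr h) (D0 h) (@muphir h) (valP f).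
have Ll := sqint_comp (@measurable_mulgl G (g^-1)%g) ler01 (@muphil g) (valP f).
have rE f' (Lf' : f' \in sqint mu) : rtrans_op h (L2_of mu f') = L2_of mu (f' \o phir h).
  exact: (comp_op_L2_of (@measurable_mulgr h) (D0 h) (@muphir h) Lf').
have lE f' (Lf' : f' \in sqint mu) : ltrans_op g (L2_of mu f') = L2_of mu (f' \o phil g).
  exact: (comp_op_L2_of (@measurable_mulgl G (g^-1)%g) ler01 (@muphil g) Lf').
rewrite /= -L2_of_val (rE _ (valP f)) (lE _ (valP f)) (rE _ Ll) (lE _ Lr).
by congr L2_of; apply/funext => x /=; rewrite /phil /phir mulgA.
Qed.

End right.
End haar_translations.

(** * Density of indicators of cosets *)

Section closed_subspaces.
Context d (T : measurableType d) (R : realType).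
Variable mu : {measure set T -> \bar R}.
Implicit Types xi eta : L2 mu.

Lemma ip_small xi : (forall eps : R, 0 < eps -> ip xi xi <= eps) -> xi = 0.
Proof.
move=> h; apply: ip_eq0; apply/eqP; rewrite eq_le ip_ge0 andbT.
by apply/ler_addgt0Pr => eps /h; rewrite add0r.
Qed.

Lemma closed_subspace_ker (D : L2 mu -> L2 mu) M : linear D -> 0 <= M ->
  (forall xi, ip (D xi) (D xi) <= M * ip xi xi) ->
  closed_subspace (fun xi => D xi = 0).
Proof.
move=> lD M0 hM.
have DD xi eta : D (xi + eta) = D xi + D eta.
  by have := lD 1 xi eta; rewrite !scale1r.
have D0 : D 0 = 0 by apply: (addrI (D 0)); rewrite -DD !addr0.
have DZ z xi : D (z *: xi) = z *: D xi.
  by have := lD z xi 0; rewrite !addr0 D0 addr0.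
split.
- by move=> xi eta; rewrite DD => -> ->; rewrite addr0.
- by move=> z xi; rewrite DZ => ->; rewrite scaler0.
- move=> xi h; apply: ip_small => eps eps0.
  have M1 : 0 < M + 1 by lra.
  have [//|eta De le] := h (eps / (M + 1)); first by rewrite divr_gt0.
  have -> : D xi = D (xi - eta).
    by rewrite DD -scaleN1r DZ De scaler0 addr0.
  apply: le_trans (hM _) _.
  apply: (@le_trans _ _ (M * (eps / (M + 1)))); first by rewrite ler_wpM2l.
  by rewrite mulrCA ger_pMr// ler_pdivrMr// mul1r; lra.
Qed.

Lemma closed_subspace_eq (A B : L2 mu -> L2 mu) : bounded_op A -> bounded_op B ->
  closed_subspace (fun xi => A xi = B xi).
Proof.
move=> bA bB; have [lA _] := bA; have [lB _] := bB.
have [M M0 hM] := bounded_op_ip bA; have [N N0 hN] := bounded_op_ip bB.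
have := @closed_subspace_ker (fun xi => A xi - B xi) (2 * M + 2 * N) _ _ _.
case.
- by move=> a xi eta; rewrite lA lB scalerBr opprD addrACA.
- by rewrite addr_ge0// mulr_ge0.
- move=> xi; have := hM xi; have := hN xi; have := ip_ge0 (A xi + B xi).
  have ipNr (u v : L2 mu) : ip u (- v) = - ip u v by rewrite ipC ipNl ipC.
  rewrite !(ipDl, ipDr, ipNl, ipNr) (ipC (B xi) (A xi)); lra.
- move=> a b c; split.
  + move=> xi eta h h'; apply/eqP; rewrite -subr_eq0; apply/eqP; apply: a.
      by rewrite h subrr.
    by rewrite h' subrr.
  + by move=> z xi h; apply/eqP; rewrite -subr_eq0; apply/eqP; apply: b; rewrite h subrr.
  + move=> xi h; apply/eqP; rewrite -subr_eq0; apply/eqP; apply: c => eps /h[eta e1 e2].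
    by exists eta => //; apply/eqP; rewrite subr_eq0; apply/eqP.
Qed.

Lemma closed_subspace0 : closed_subspace (fun xi => xi = 0).
Proof.
split; first by move=> xi eta -> ->; rewrite addr0.
  by move=> z xi ->; rewrite scaler0.
move=> xi h; apply: ip_small => eps /h[_ ->]; by rewrite subr0.
Qed.

Lemma closed_subspace_orth eta :
  closed_subspace (fun xi => forall z, ip eta (z *: xi) = 0).
Proof.
split.
- by move=> xi xi' h h' z; rewrite scalerDr ipDr h h' addr0.
- by move=> z xi h z'; rewrite scalerA.
- move=> xi h z; apply/eqP; rewrite -sqrf_eq0 eq_le sqr_ge0 andbT.
  apply/ler_addgt0Pr => eps eps0; rewrite add0r.
  set c := complex.Re z ^+ 2 + complex.Im z ^+ 2.
  have c0 : 0 <= c by rewrite addr_ge0// sqr_ge0.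
  set M := ip eta eta * c + 1.
  have M1 : 0 < M by rewrite ltr_wpDl// mulr_ge0// ip_ge0.
  have [|xi' h' le] := h (eps / M); first by rewrite divr_gt0.
  have -> : ip eta (z *: xi) = ip eta (z *: (xi - xi')).
    by rewrite scalerDr ipDr scalerN ipC (ipC eta (- _)) ipNl
      (ipC _ eta) (ipC _ eta) h' oppr0 addr0.
  apply: le_trans (cauchy_schwarz _ _) _; rewrite ip_scale -/c mulrA.
  apply: (@le_trans _ _ (ip eta eta * c * (eps / M))).
    by rewrite ler_wpM2l// mulr_ge0// ip_ge0.
  by rewrite mulrCA ger_pMr// ler_pdivrMr// mul1r /M lerDl.
Qed.

End closed_subspaces.

Section haar_cosets.
Variables (R : realType) (G : topologicalGroupType).
Variable mu : {measure set (borel G) -> \bar R}.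
Hypothesis G_hausdorff : hausdorff_space G.
Hypothesis hmu : left_haar mu.

Lemma compact_fin_meas (C : set G) : compact C -> fin_meas mu C.
Proof.
by move=> cC; split; [exact: compact_measurable|exact: haar_compact].
Qed.

Section density_cosets.
Variables (c : nat -> G -> set G) (cs : coset_system c) (N : nat).
Hypothesis fc : forall n x, fin_meas mu (c n x).

Lemma finmeas_union n (s : seq G) : fin_meas mu (\big[setU/set0]_(x <- s) c n x).
Proof.
elim: s => [|a s IH]; first by rewrite big_nil; exact: fin_meas0.
by rewrite big_cons; exact: fin_measU.
Qed.

(** Outer regularity gives an open [U] around [A], inner regularity a compact
    [C] in [U], and the union [W] of the cosets of a fine enough level that meet
    [C] lies between [C] and [U]; all three differ little from [A] in volume. *)
Lemma approx_cosets (A : set (borel G)) (eps : R) : fin_meas mu A -> 0 < eps ->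
  exists n (s : seq G) (W : set (borel G)), [/\ (N <= n)%N, partition_by W s (c n),
    fin_meas mu W & ip (ind mu A - ind mu W) (ind mu A - ind mu W) <= eps].
Proof.
move=> fA eps0; have [mA _] := fA; have e2 : 0 < eps / 2 by rewrite divr_gt0.
have muAfin : mu A \is a fin_num by rewrite (fin_measE fA).
have [U [oU AU] muU] : exists2 U : set G, open U /\ A `<=` U & (mu U < mu A + (eps / 2)%:E)%E.
  have Afin : ereal_inf [set mu U | U in [set U : set G | open U /\ A `<=` U]] \is a fin_num.
    by rewrite -haar_outer.
  have [_ [U hU <-]] := @lb_ereal_inf_adherent R _ _ e2 Afin.
  by rewrite -haar_outer// => lt; exists U.
have mU := open_measurable oU.
have fU : fin_meas mu U.
  by split=> //; apply: lt_le_trans muU _; rewrite leey.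
have muUfin : mu U \is a fin_num by rewrite (fin_measE fU).
have [C [cC CU] muC] : exists2 C : set G, compact C /\ C `<=` U & (mu U - (eps / 2)%:E < mu C)%E.
  have Ufin : ereal_sup [set mu C | C in [set C : set G | compact C /\ C `<=` U]] \is a fin_num.
    by rewrite -haar_inner.
  have [_ [C hC <-]] := @ub_ereal_sup_adherent R _ _ e2 Ufin.
  by rewrite -haar_inner// => lt; exists C.
have fC := compact_fin_meas cC.
have [n Nn hn] := compact_level cs N cC oU CU.
have [s [us sC sep scov]] := compact_cosets cs n cC.
pose W := \big[setU/set0]_(x <- s) c n x.
have WE z : W z <-> exists2 x, x \in s & c n x z.
  rewrite /W -bigcup_seq; split; first by move=> [x /= xs cz]; exists x.
  by move=> [x xs cz]; exists x.
have fW : fin_meas mu W by exact: finmeas_union.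
exists n, s, W; split=> //.
  split=> // x y xs ys z cx cy; apply: sep => //.
  by rewrite -(cs_eq cs cx) (cs_eq cs cy); exact: cs_refl.
have CW : C `<=` W by move=> z /scov/WE.
have WU : W `<=` U by move=> z /WE[x /sC Cx]; exact: hn.
have ipNr (u v : L2 mu) : ip u (- v) = - ip u v by rewrite ipC ipNl ipC.
rewrite !(ipDl, ipDr, ipNl, ipNr) !ip_ind// !setIid (setIC W).
have dec (X Y : set (borel G)) : fin_meas mu X -> fin_meas mu Y ->
    vol mu X = vol mu (X `&` Y) + vol mu (X `\` Y).
  move=> fX fY; rewrite -volU//; last 2 first.
  - exact: fin_measD.
  - by rewrite setDE setIACA setICr setI0.
  - by rewrite setUIDK.
  by apply: (fin_measS _ (@subIsetl _ X Y) fX); apply: measurableI; [case: fX|case: fY].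
have sub (X Y Z : set (borel G)) : fin_meas mu X -> fin_meas mu Y -> fin_meas mu Z ->
    X `<=` Z -> vol mu (X `\` Y) <= vol mu (Z `\` Y).
  move=> fX fY fZ XZ; apply: vol_le; [exact: fin_measD..|].
  by move=> z [Xz nYz]; split=> //; exact: XZ.
have h1 := dec _ _ fA fW; have h2 := dec _ _ fW fA.
have h3 := dec _ _ fU fW; have h4 := dec _ _ fU fA.
have h5 := sub _ _ _ fA fW fU AU; have h6 := sub _ _ _ fW fA fU WU.
rewrite (setIidr WU) in h3; rewrite (setIidr AU) in h4; rewrite (setIC W A) in h2.
have h7 := vol_le fC fW CW.
have h8 : vol mu U < vol mu A + eps / 2.
  by rewrite -lte_fin EFinD -(fin_measE fU) -(fin_measE fA).
have h9 : vol mu U - eps / 2 < vol mu C.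
  by rewrite -lte_fin EFinB -(fin_measE fU) -(fin_measE fC).
lra.
Qed.

Lemma dense_cosets (P : L2 mu -> Prop) : closed_subspace P ->
  (forall n x, (N <= n)%N -> P (ind mu (c n x))) -> forall xi, P xi.
Proof.
move=> cP Pc; apply: dense_L2 => // A fA; apply: (csub_lim cP) => eps eps0.
have [n [s [W [Nn pW fW le]]]] := approx_cosets fA eps0.
exists (ind mu W) => //; rewrite (ind_partition fW _ pW); last by move=> i _; case: (fc n i).
elim: (s) => [|a s' IH]; last by rewrite big_cons; apply: (csub_add cP) => //; exact: Pc.
by rewrite big_nil -(scale0r (ind mu (c N 1%g))); apply: (csub_scale cP); exact: Pc.
Qed.
End density_cosets.

Section basis.
Variables (K : nat -> set G) (cobK : compact_open_basis K).

Lemma fin_measK n : fin_meas mu (K n).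
Proof. by apply: compact_fin_meas; exact: (cob_compact cobK). Qed.

(** If [K n] were null, all indicators of cosets of finer levels would vanish,
    hence by density the whole L2 space; then every compact set is null, and the
    measure is zero by inner regularity. *)
Lemma volK_gt0 n : 0 < vol mu (K n).
Proof.
rewrite lt_neqAle vol_ge0 andbT; apply: contra (haar_neq0 hmu) => /eqP v0.
have L20 : forall xi : L2 mu, xi = 0.
  apply: (@dense_cosets _ (lcoset_system cobK) n) => [m x||m x nm].
  - by apply: fin_meas_lcoset => //; exact: fin_measK.
  - exact: closed_subspace0.
  - apply: ip_eq0; rewrite ip_ind ?setIid; try exact/fin_meas_lcoset/fin_measK.
    rewrite vol_lcoset//; last exact: fin_measK.
    apply/eqP; rewrite eq_le vol_ge0 andbT v0; apply: vol_le; try exact: fin_measK.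
    exact: (cob_homo cobK nm).
rewrite (haar_inner hmu openT); apply/eqP/le_anti/andP; split; last first.
  by apply: ereal_sup_ubound; exists set0 => //; split=> //; exact: compact0.
apply: ge_ereal_sup => _ [C [cC _] <-].
have fC := compact_fin_meas cC; rewrite (fin_measE fC).
have := ip_ind fC fC; rewrite setIid (L20 (ind mu C)) ip0l /vol => <-.
by [].
Qed.

End basis.
End haar_cosets.

(** * Operators commuting with translations *)

Lemma partition_lcoset (G : groupType) (I : eqType) (A : set G) (s : seq I)
    (B : I -> set G) x :
  partition_by A s B -> partition_by (lcoset x A) s (fun i => lcoset x (B i)).
Proof.
move=> p; split; first exact: part_uniq p.
  move=> z; rewrite lcosetP (part_mem p).
  by split=> -[i si]; [move=> Bi; exists i => //; rewrite lcosetP|rewrite lcosetP; exists i].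
by move=> i j si sj z; rewrite !lcosetP; exact: (part_disj p).
Qed.

Section linear_maps.
Context d (T : measurableType d) (R : realType) (mu : {measure set T -> \bar R}).
Variable A : L2 mu -> L2 mu.
Hypothesis lA : linear A.

Lemma linD xi eta : A (xi + eta) = A xi + A eta.
Proof. by have := lA 1 xi eta; rewrite !scale1r. Qed.
Lemma lin0 : A 0 = 0.
Proof. by apply: (addrI (A 0)); rewrite -linD !addr0. Qed.
Lemma linZ z xi : A (z *: xi) = z *: A xi.
Proof. by have := lA z xi 0; rewrite !addr0 lin0 addr0. Qed.
Lemma lin_sum I (s : seq I) (F : I -> L2 mu) :
  A (\sum_(i <- s) F i) = \sum_(i <- s) A (F i).
Proof. exact: (big_morph A linD lin0). Qed.

End linear_maps.

Lemma bounded_scale d (T : measurableType d) (R : realType)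
  (mu : {measure set T -> \bar R}) (z : R[i]) (A : L2 mu -> L2 mu) :
  bounded_op A -> bounded_op (fun xi => z *: A xi).
Proof.
move=> bA; have [lA _] := bA; have [M M0 hM] := bounded_op_ip bA.
set c := complex.Re z ^+ 2 + complex.Im z ^+ 2.
have c0 : 0 <= c by rewrite addr_ge0// sqr_ge0.
apply: (@ip_bounded_op _ _ _ _ _ (c * M)).
  by move=> a xi eta; rewrite lA scalerDr !scalerA mulrC.
by move=> xi; rewrite ip_scale -/c -mulrA ler_wpM2l.
Qed.

Lemma sum_const_seq (R : pzRingType) (I : eqType) (s : seq I) (F : I -> R) c :
  (forall i, i \in s -> F i = c) -> \sum_(i <- s) F i = (size s)%:R * c.
Proof.
move=> h; rewrite (eq_big_seq (fun=> c))//.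
by rewrite big_const_seq count_predT iter_addr_0 mulr_natl.
Qed.

Section core.
Variables (R : realType) (G : topologicalGroupType).
Variable mu : {measure set (borel G) -> \bar R}.
Hypothesis G_hausdorff : hausdorff_space G.
Hypothesis hmu : left_haar mu.
Variable Delta : G -> R.
Hypothesis Delta_modular : modular_function mu Delta.
Variables (K : nat -> set G).
Hypothesis cobK : compact_open_basis K.
Variable H : set G.

(** The hypothesis on orbits in a form that passes to a subgroup: the elements
    of an orbit are listed by the elements of [H] that produce them. *)
Definition many_conjugates (x : G) := forall (C : R) N, exists n p (h : 'I_p -> G),
  [/\ (N <= n)%N, forall i, H (h i) /\ conjset (h i) (K n) = K n,
    forall i j, lcoset (h i * x * (h i)^-1)%g (K n) (h j * x * (h j)^-1)%g -> i = j &
    C < p%:R * vol mu (K n) ^+ 2].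

Hypothesis orbits : forall x, x != 1%g -> many_conjugates x.

Local Notation v n := (vol mu (K n)).
Local Notation e := (ind mu).
Local Notation eL n x := (e (lcoset x (K n))).
Local Notation sgK n := (cob_subgroup cobK n).

Let fK n : fin_meas mu (K n). Proof. exact: fin_measK. Qed.
Let fL n x : fin_meas mu (lcoset x (K n)). Proof. exact: fin_meas_lcoset. Qed.
Let fR n x : fin_meas mu (rcoset (K n) x).
Proof. exact: (fin_meas_rcoset Delta_modular). Qed.
Let v0 n : 0 < v n. Proof. exact: (volK_gt0 G_hausdorff hmu cobK). Qed.

Lemma modular_subgroup n k : K n k -> Delta k = 1.
Proof.
move=> Kk; have := vol_rcoset Delta_modular k (fK n).
rewrite (sg_rcoset (sgK n) Kk) => /eqP; rewrite -{1}[v n]mul1r eq_sym.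
by rewrite (inj_eq (mulIf (lt0r_neq0 (v0 n)))) => /eqP.
Qed.

(** A normalizing element preserves the volume of [K n], so its modulus is [1]. *)
Lemma modular_normalizer n h : conjset h (K n) = K n -> Delta (h^-1)%g = 1.
Proof.
move=> hK; have := vol_rcoset Delta_modular (h^-1)%g (fK n).
rewrite -(vol_lcoset hmu h (fR n (h^-1)%g)) -conjsetE hK => /eqP.
rewrite -{1}[v n]mul1r eq_sym.
by rewrite (inj_eq (mulIf (lt0r_neq0 (v0 n)))) => /eqP.
Qed.

Record commuting (T : L2 mu -> L2 mu) : Prop := {
  com_bounded : bounded_op T;
  com_left : forall h, H h -> forall xi, T (ltrans_op h xi) = ltrans_op h (T xi);
  com_right : forall g xi, T (rtrans_op g xi) = rtrans_op g (T xi)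
}.

Lemma commuting_scale z T : commuting T -> commuting (fun xi => z *: T xi).
Proof.
move=> cT; split; first exact: bounded_scale (com_bounded cT).
  by move=> h Hh xi; rewrite (com_left cT Hh) (linZ (ltrans_op_linear hmu h)).
by move=> g xi; rewrite (com_right cT) (linZ (rtrans_op_linear Delta_modular g)).
Qed.

Section one_operator.
Variable T : L2 mu -> L2 mu.
Hypothesis cT : commuting T.
Let bT := com_bounded cT.
Let lT : linear T := bT.1.

Lemma T_rcoset A k : fin_meas mu A -> T (e (rcoset A k)) = rtrans_op (k^-1)%g (T (e A)).
Proof. by move=> fA; rewrite -(com_right cT) (rtrans_op_ind Delta_modular)// invgK. Qed.

Lemma ip_right_invariant n k A : K n k -> fin_meas mu A ->
  ip (T (e (K n))) (e (rcoset A k)) = ip (T (e (K n))) (e A).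
Proof.
move=> Kk fA; rewrite -{1}(sg_rcoset (sgK n) Kk) T_rcoset//.
have -> : e (rcoset A k) = rtrans_op (k^-1)%g (e A).
  by rewrite (rtrans_op_ind Delta_modular)// invgK.
by rewrite (rtrans_op_ip Delta_modular) invgK (modular_subgroup Kk) mul1r.
Qed.

Lemma K_rcosets n l : (n <= l)%N -> exists2 s : seq G,
  partition_by (K n) s (rcoset (K l)) & forall k, k \in s -> K n k.
Proof.
move=> nl; apply: (coset_partition (n := l) (rcoset_system cobK)).
  exact: cob_compact cobK n.
move=> x Kx y /rcosetP/(cob_homo cobK nl) h.
by rewrite -(mulgVK x y); exact: (sgM (sgK n)).
Qed.

Lemma rcosets_index n l (s : seq G) : (n <= l)%N ->
  partition_by (K n) s (rcoset (K l)) -> (forall k, k \in s -> K n k) ->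
  v n = (size s)%:R * v l.
Proof.
move=> nl ps sK; rewrite (vol_partition (fK n) _ ps); last by move=> i _; case: (fR l i).
apply: sum_const_seq => k ks.
by rewrite (vol_rcoset Delta_modular)// (modular_subgroup (sK _ ks)) mul1r.
Qed.

(** [T (e (K n))] is invariant under right translation by [K n], and these
    translations permute transitively the pieces [x K_l k] of [x K_n]. *)
Lemma ip_refine_right n l x : (n <= l)%N ->
  v n * ip (T (e (K n))) (eL l x) = v l * ip (T (e (K n))) (eL n x).
Proof.
move=> nl; have [s ps sK] := K_rcosets nl.
have px := partition_lcoset x ps.
rewrite (ip_ind_partition _ (fL n x) _ px); last first.
  by move=> k _; have [] := fin_meas_lcoset hmu x (fR l k).
rewrite (sum_const_seq (c := ip (T (e (K n))) (eL l x))); last first.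
  by move=> k /sK Kk; rewrite -lrcoset ip_right_invariant.
rewrite (rcosets_index nl ps sK); ring.
Qed.

(** Now it is [K n] that is cut into the pieces [K_l k]; right translation by [k]
    fixes [x K_n], so all pieces contribute equally. *)
Lemma ip_refine_left n l x : (n <= l)%N ->
  v l * ip (T (e (K n))) (eL n x) = v n * ip (T (e (K l))) (eL n x).
Proof.
move=> nl; have [s ps sK] := K_rcosets nl.
rewrite (ind_partition (fK n) _ ps); last by move=> k _; case: (fR l k).
rewrite (lin_sum lT) ipC ip_sumr (sum_const_seq (c := ip (T (e (K l))) (eL n x))).
  rewrite (rcosets_index nl ps sK); ring.
move=> k /sK Kk; rewrite ipC T_rcoset//.
have -> : eL n x = rtrans_op (k^-1)%g (eL n x).
  by rewrite (rtrans_op_ind Delta_modular)// invgK lrcoset (sg_rcoset (sgK n) Kk).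
rewrite (rtrans_op_ip Delta_modular) invgK (modular_subgroup Kk) mul1r.
by rewrite (rtrans_op_ind Delta_modular)// invgK lrcoset (sg_rcoset (sgK n) Kk).
Qed.

(** The mass of [x K_n] under the formal image by [T] of the Dirac mass at [1];
    [ip_refine_left] says that it may be computed at any finer level. *)
Definition mass n x := ip (T (e (K n))) (eL n x) / v n.

Definition small_density eps n x := `|mass n x| <= eps * v n.

Lemma small_density_eq eps n x y : lcoset x (K n) y ->
  small_density eps n y = small_density eps n x.
Proof. by move=> h; rewrite /small_density /mass (lcoset_eq (sgK n) h). Qed.

(** Both the mass and the volume of [x K_n] are sums over its subcosets of the
    next level. *)
Lemma small_density_step eps n x :
  (forall y, lcoset x (K n) y -> small_density eps n.+1 y) -> small_density eps n x.
Proof.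
move=> h; have [s ps sx] : exists2 s : seq G,
    partition_by (lcoset x (K n)) s (fun y => lcoset y (K n.+1)) &
    forall y, y \in s -> lcoset x (K n) y.
  apply: (coset_partition (n := n.+1) (lcoset_system cobK)).
    exact (@compact_lcoset G x (K n) (cob_compact cobK (n:=n))).
  move=> y xy z yz; rewrite -(lcoset_eq (sgK n) xy).
  exact: (cs_dec (lcoset_system cobK)).
have dE : mass n x = \sum_(y <- s) mass n.+1 y.
  rewrite /mass -mulr_suml -(ip_ind_partition _ (fL n x) _ ps); last first.
    by move=> y _; case: (fL n.+1 y).
  have := ip_refine_left x (leqnSn n) => E.
  by apply/eqP; rewrite eqr_div ?lt0r_neq0// mulrC E mulrC.
rewrite /small_density dE -(vol_lcoset hmu x (fK n)).
rewrite (vol_partition (fL n x) _ ps); last by move=> y _; case: (fL n.+1 y).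
rewrite mulr_sumr; apply: le_trans (ler_norm_sum _ _ _) _.
rewrite big_seq [leRHS]big_seq; apply: ler_sum => y /sx /h.
by rewrite vol_lcoset.
Qed.

(** Conjugation by [h] is composed of a left and a right translation, commutes
    with [T] and fixes the indicator of [K n]. *)
Lemma orbit_invariant n x h : H h -> conjset h (K n) = K n ->
  ip (T (e (K n))) (eL n (h * x * h^-1)%g) = ip (T (e (K n))) (eL n x).
Proof.
move=> Hh hK.
have LR A : fin_meas mu A -> e (conjset h A) = ltrans_op h (rtrans_op h (e A)).
  move=> fA; rewrite conjsetE (rtrans_op_ind Delta_modular)// (ltrans_op_ind hmu)//.
  exact: (fin_meas_rcoset Delta_modular).
have -> : eL n (h * x * h^-1)%g = ltrans_op h (rtrans_op h (eL n x)).
  rewrite -LR//; congr (e _); rewrite conjsetE lrcoset -lcosetM.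
  rewrite -{1}hK conjsetE -lcosetM; congr lcoset.
  by rewrite -!mulgA mulVg mulg1.
rewrite -{1}hK LR// (com_left cT Hh) (com_right cT) (ltrans_op_ip hmu).
by rewrite (rtrans_op_ip Delta_modular) (modular_normalizer hK) mul1r.
Qed.

(** Cauchy-Schwarz against the sum [S] of the indicators of the [p] disjoint
    conjugate cosets: all pair equally with [T (e (K n))], and the squared norm
    of [S] is [p] times the volume of [K n]. *)
Lemma orbit_bound M n x p (h : 'I_p -> G) : 0 <= M ->
    (forall xi, ip (T xi) (T xi) <= M * ip xi xi) ->
    (forall i, H (h i) /\ conjset (h i) (K n) = K n) ->
    (forall i j, lcoset (h i * x * (h i)^-1)%g (K n) (h j * x * (h j)^-1)%g -> i = j) ->
  p%:R * mass n x ^+ 2 <= M.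
Proof.
move=> M0 hM hH hinj; set t := ip (T (e (K n))) (eL n x).
pose y i := (h i * x * (h i)^-1)%g.
pose S := \sum_(i < p) eL n (y i).
have tS : ip (T (e (K n))) S = p%:R * t.
  rewrite ip_sumr -[in RHS](size_enum_ord p) -(sum_const_seq (F := fun=> t))//.
  rewrite [in RHS]big_enum /=; apply: eq_bigr => i _.
  by have [Hi Ki] := hH i; exact: orbit_invariant.
have SS : ip S S = p%:R * v n.
  rewrite {1}/S ipC ip_sumr -[in RHS](size_enum_ord p) -(sum_const_seq (F := fun=> v n))//.
  rewrite [in RHS]big_enum /=; apply: eq_bigr => i _.
  rewrite ipC /S ip_sumr (bigD1 i)//= ip_ind// setIid vol_lcoset// big1 ?addr0// => j ji.
  rewrite ip_ind// (_ : _ `&` _ = set0) ?vol0//.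
  apply/seteqP; split=> // z [zi zj]; case/eqP: ji; apply: hinj.
  rewrite -/(y i) -/(y j) -(lcoset_eq (sgK n) zj) (lcoset_eq (sgK n) zi).
  exact: (cs_refl (lcoset_system cobK)).
have := cauchy_schwarz (T (e (K n))) S.
rewrite tS SS => cs.
have le := hM (e (K n)); rewrite ip_ind// setIid in le.
have vn := v0 n.
have [->|p0] := eqVneq p 0; first by rewrite mul0r.
have p1 : 0 < p%:R :> R by rewrite ltr0n lt0n.
rewrite /mass -/t expr_div_n mulrA ler_pdivrMr ?exprn_gt0//.
rewrite -(ler_pM2l p1); apply: (@le_trans _ _ ((p%:R * t) ^+ 2)); first by rewrite exprMn; lra.
apply: le_trans cs _; apply: (@le_trans _ _ (M * v n * (p%:R * v n))).
  by rewrite ler_wpM2r// mulr_ge0// ltW.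
by rewrite le_eqVlt; apply/orP; left; apply/eqP; ring.
Qed.

Lemma small_density_deep eps x N : 0 < eps -> x != 1%g ->
  exists2 n, (N <= n)%N & small_density eps n x.
Proof.
move=> eps0 /orbits orb; have [M M0 hM] := bounded_op_ip bT.
(* [M] bounds the squared norm of [T], so this many conjugates force the
   mass below [eps * v n] in [orbit_bound]. *)
have [n [p [h [Nn hH hinj Cp]]]] := orb (M / eps ^+ 2) N.
exists n => //; have := orbit_bound M0 hM hH hinj.
move: Cp; rewrite ltr_pdivrMr ?exprn_gt0// => Cp le.
have p1 : 0 < p%:R :> R.
  rewrite ltr0n lt0n; apply/eqP => p0.
  by move: Cp; rewrite p0 !mul0r; apply/negP; rewrite -leNgt.
have b0 : 0 <= eps * v n by rewrite mulr_ge0 ?ltW.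
rewrite /small_density -ler_sqr ?nnegrE// real_normK ?num_real//.
rewrite -(ler_pM2l p1) [(eps * _) ^+ 2]exprMn; apply: (le_trans le).
by apply: ltW; apply: lt_le_trans Cp _; rewrite le_eqVlt; apply/orP; left; apply/eqP; ring.
Qed.

(** Since [x K_n] is compact and avoids [1], there is one [k] such that each of
    its points has a coset of small density of level between [n] and [n + k].
    The level [n + k] is then removed: a coset of level one less either meets a
    coset of small density that is at least as large, and is contained in it, or
    splits into cosets of level [n + k] that all have small density. *)
Lemma small_density_outside eps n x : 0 < eps -> ~ K n x -> small_density eps n x.
Proof.
move=> eps0 nKx; pose A := lcoset x (K n).
have A1 y : A y -> y != 1%g.
  move=> Ay; apply/eqP => y1; apply: nKx; move: Ay; rewrite y1 /A lcosetP mulg1.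
  by move=> /(sgV (sgK n)); rewrite invgK.
pose V k : set G := [set y | exists l, [/\ (n <= l)%N, (l <= n + k)%N & small_density eps l y]].
have [k Vk] : exists k, A `<=` V k.
  apply: compact_increasing.
  - exact: (@compact_lcoset G x (K n) (cob_compact cobK (n:=n))).
  - move=> k; rewrite openE => y /= [l [nl lk gl]].
    apply: (@filterS _ _ _ (lcoset y (K l))).
      by move=> z yz /=; exists l; split=> //; rewrite (small_density_eq _ yz).
    apply: open_nbhs_nbhs; split; first exact: (cs_open (lcoset_system cobK)).
    exact: (cs_refl (lcoset_system cobK)).
  - by move=> k y [l [nl lk gl]]; exists l; split=> //; rewrite addnS ltnW.
  - move=> y /A1 /(small_density_deep n eps0)[l nl gl].
    by exists (l - n)%N, l; split=> //; rewrite subnKC.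
elim: k Vk => [|k IH] Vk.
  have [l [nl]] := Vk x (cs_refl (lcoset_system cobK) n x).
  by rewrite addn0 => ln gl; have -> : n = l by apply/eqP; rewrite eqn_leq nl ln.
apply: IH => y Ay.
have yA : lcoset y (K (n + k)) `<=` A.
  rewrite /A -(lcoset_eq (sgK n) Ay).
  by apply: (cs_homo (lcoset_system cobK)); exact: leq_addr.
have [[z yz [l [nl lk gl]]]|no] :=
    pselect (exists2 z, lcoset y (K (n + k)) z & V k z).
  exists l; split=> //; rewrite -(small_density_eq eps (y := z))//.
  exact: (cs_homo (lcoset_system cobK) lk).
exists (n + k)%N; split=> //; first exact: leq_addr.
apply: small_density_step => z yz; have [l [nl + gl]] := Vk z (yA z yz).
rewrite leq_eqVlt => /predU1P[lE|]; first by rewrite -addnS -lE.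
by rewrite addnS ltnS => lk; exfalso; apply: no; exists z => //; exists l.
Qed.

Lemma mass_outside n x : ~ K n x -> mass n x = 0.
Proof.
move=> nKx; apply/eqP; rewrite -normr_le0; apply/ler_addgt0Pr => eps eps0.
have := small_density_outside (divr_gt0 eps0 (v0 n)) nKx.
by rewrite /small_density divfK ?lt0r_neq0// add0r.
Qed.

(** Against small cosets, [T (e (K n))] cannot be told from a real multiple of
    [e (K n)]; it may still differ from it by an imaginary multiple. *)
Lemma ip_coset n l x : (n <= l)%N ->
  ip (T (e (K n))) (eL l x) = mass n 1%g * ip (e (K n)) (eL l x).
Proof.
move=> nl; have dE := ip_refine_right x nl.
have {}dE : ip (T (e (K n))) (eL l x) = v l * mass n x.
  by apply: (mulfI (lt0r_neq0 (v0 n))); rewrite dE /mass; field; exact: lt0r_neq0.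
rewrite dE ip_ind//; have [Kx|nKx] := pselect (K n x).
  have -> : mass n x = mass n 1%g.
    by rewrite /mass (sg_lcoset (sgK n) Kx) lcoset1.
  rewrite mulrC (_ : K n `&` _ = lcoset x (K l)) ?vol_lcoset//.
  apply: setIidr => y /lcosetP /(cob_homo cobK nl) h.
  by rewrite -(mulVKg x y); exact: (sgM (sgK n)).
rewrite mass_outside// (_ : K n `&` _ = set0) ?vol0 ?mulr0//.
apply/seteqP; split=> // y [Ky /lcosetP /(cob_homo cobK nl) h]; apply: nKx.
by have := sgM (sgK n) Ky (sgV (sgK n) h); rewrite -{1}(mulVKg x y) mulgK.
Qed.

End one_operator.

(** [ip_coset] for [T] gives the real part of the eigenvalue and for ['i *: T]
    its imaginary part. *)
Lemma commuting_eigen T n : commuting T -> exists c : R[i], T (e (K n)) = c *: e (K n).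
Proof.
move=> cT; have ciT := commuting_scale 'i%C cT.
pose a := mass T n 1%g; pose b := mass (fun xi => 'i%C *: T xi) n 1%g.
(* [b] is the real part of ['i * c], hence the sign. *)
pose c : R[i] := Complex a (- b); exists c.
pose D := T (e (K n)) - c *: e (K n).
have D1 l x : (n <= l)%N -> ip D (eL l x) = 0.
  move=> nl; rewrite ipDl ipNl (ip_coset cT)// scaleCE ipDl !ipZ -/a /=.
  by rewrite ip_i_ind// mulr0 addr0 subrr.
have D2 l x : (n <= l)%N -> ip ('i%C *: D) (eL l x) = 0.
  move=> nl; rewrite scalerBr ipDl ipNl (ip_coset ciT)// scalerA.
  have -> : 'i%C * c = Complex b a by rewrite /c; simpc.
  by rewrite scaleCE ipDl !ipZ /= ip_i_ind// mulr0 addr0 subrr.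
have Dorth : forall xi z, ip D (z *: xi) = 0.
  apply: (@dense_cosets _ _ _ G_hausdorff hmu _ (lcoset_system cobK) n) => //.
    exact: closed_subspace_orth.
  move=> l x nl z; rewrite scaleCE ipDr !ipZr D1// mulr0 add0r.
  by have := ipJ D (eL l x); rewrite D2// => /esym/eqP; rewrite oppr_eq0 => /eqP ->; rewrite mulr0.
by apply/eqP; rewrite -subr_eq0; apply/eqP/ip_eq0; have := Dorth D 1; rewrite scale1r.
Qed.

Theorem commuting_scalar T : commuting T -> scalar_ops T.
Proof.
move=> cT; have lT : linear T := (com_bounded cT).1.
have [c c0] := commuting_eigen 0 cT; exists c.
have TR n g a : T (e (K n)) = a *: e (K n) ->
    T (e (rcoset (K n) g)) = a *: e (rcoset (K n) g).
  move=> Ta; rewrite T_rcoset// Ta (linZ (rtrans_op_linear Delta_modular _)).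
  by rewrite (rtrans_op_ind Delta_modular)// invgK.
have cn n : T (e (K n)) = c *: e (K n).
  have [a an] := commuting_eigen n cT; suff -> : c = a by [].
  have [s ps sK] := K_rcosets (leq0n n).
  have : T (e (K 0)) = a *: e (K 0).
    rewrite (ind_partition (fK 0) _ ps); last by move=> k _; case: (fR n k).
    by rewrite (lin_sum lT) scaler_sumr; apply: eq_bigr => k _; exact: TR.
  rewrite c0 => /eqP; rewrite -subr_eq0 -scalerBl scaler_eq0 subr_eq0 => /orP[/eqP//|/eqP e00].
  have := v0 0; rewrite -[K 0]setIid -ip_ind// e00 ip0l.
  by rewrite ltxx.
apply/funext; apply: (@dense_cosets _ _ _ G_hausdorff hmu _ (rcoset_system cobK) 0) => //.
  apply: closed_subspace_eq; first exact: com_bounded.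
  apply: (bounded_scale c (A := id)); split=> //; exists 1 => xi; by rewrite mul1r.
by move=> n x _; apply: TR.
Qed.

End core.

(** * Existence of the modular function *)

Lemma partition_rcoset (G : groupType) (I : eqType) (A : set G) (s : seq I)
    (B : I -> set G) x :
  partition_by A s B -> partition_by (rcoset A x) s (fun i => rcoset (B i) x).
Proof.
move=> p; split; first exact: part_uniq p.
  move=> z; rewrite rcosetP (part_mem p).
  by split=> -[i si]; [move=> Bi; exists i => //; rewrite rcosetP|rewrite rcosetP; exists i].
by move=> i j si sj z; rewrite !rcosetP; exact: (part_disj p).
Qed.

(** Inside a compact open set the ratio of the volumes of [A g] and [A] is the
    same as for the small cosets that compose it, hence does not depend on [A];
    regularity extends this to Borel sets, as an inequality first. *)
Section modular_function_exists.
Variables (R : realType) (G : topologicalGroupType).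
Variable mu : {measure set (borel G) -> \bar R}.
Hypothesis G_hausdorff : hausdorff_space G.
Hypothesis hmu : left_haar mu.
Variables (K : nat -> set G) (cobK : compact_open_basis K).
Implicit Types (A U C : set G) (g : G).

Let fC A : compact A -> fin_meas mu A.
Proof. exact: compact_fin_meas. Qed.

Let fCr A g : compact A -> fin_meas mu (rcoset A g).
Proof. by move=> cA; apply: fC; exact: compact_rcoset. Qed.

Let v0 n : 0 < vol mu (K n). Proof. exact: (volK_gt0 G_hausdorff hmu cobK). Qed.

Let D g := vol mu (rcoset (K 0) g) / vol mu (K 0).

Let size_lcosets A n g (s : seq G) : compact A ->
  partition_by A s (fun x => lcoset x (K n)) ->
  vol mu (rcoset A g) = (size s)%:R * vol mu (rcoset (K n) g).
Proof.
move=> cA ps; have fKn : fin_meas mu (rcoset (K n) g) by apply: fCr; exact: cob_compact.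
have E x : rcoset (lcoset x (K n)) g = lcoset x (rcoset (K n) g) by rewrite lrcoset.
rewrite (vol_partition (fCr g cA) _ (partition_rcoset g ps)); last first.
  by move=> x _; rewrite E; case: (fin_meas_lcoset hmu x fKn).
by apply: sum_const_seq => x _; rewrite E vol_lcoset.
Qed.

Let vol_rcoset_co A g : compact A -> open A -> vol mu (rcoset A g) = D g * vol mu A.
Proof.
move=> cA oA; have [n _ hn] := compact_level (lcoset_system cobK) 0 cA oA (fun _ => id).
have [s ps _] := coset_partition (lcoset_system cobK) cA hn.
have [s0 ps0 _] : exists2 s0 : seq G,
    partition_by (K 0) s0 (fun x => lcoset x (K n)) & forall x, x \in s0 -> K 0 x.
  apply: (coset_partition (n := n) (lcoset_system cobK)); first exact: cob_compact.
  move=> x Kx y /lcosetP /(cob_homo cobK (leq0n n)) h.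
  by rewrite -(mulVKg x y); exact: (sgM (cob_subgroup cobK 0)).
rewrite -[in RHS](rcoset1 A) (size_lcosets g cA ps) (size_lcosets 1%g cA ps) rcoset1.
have cK0 := cob_compact cobK (n:=0).
have h1 := size_lcosets g cK0 ps0; have h2 := size_lcosets 1%g cK0 ps0.
rewrite !rcoset1 in h2.
have s00 : (size s0)%:R != 0 :> R.
  by apply/eqP => s00; have := v0 0; rewrite h2 s00 mul0r ltxx.
rewrite /D h1 h2; by field; rewrite s00 (lt0r_neq0 (v0 n)).
Qed.

Let DV g : D (g^-1)%g * D g = 1.
Proof.
have cK0 := cob_compact cobK (n:=0); have oK0 := cob_open cobK 0.
have := vol_rcoset_co (g^-1)%g (compact_rcoset (g:=g) cK0) (open_rcoset g oK0).
rewrite -rcosetM mulgV rcoset1 vol_rcoset_co// => h.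
by apply: (mulIf (lt0r_neq0 (v0 0))); rewrite mul1r -mulrA -h.
Qed.

Let D_gt0 g : 0 < D g.
Proof.
rewrite lt_neqAle divr_ge0 ?vol_ge0// andbT; apply/eqP => h.
by have := DV g; rewrite -h mulr0 => /esym/eqP; rewrite oner_eq0.
Qed.

Let mu_rcoset_open U g : open U ->
  (mu (rcoset U g) <= (D g)%:E * mu U)%E.
Proof.
move=> oU; have oUg := open_rcoset g oU.
rewrite (haar_inner hmu oUg); apply: ge_ereal_sup => _ [C [cC CU] <-].
have cs := lcoset_system cobK.
have [n _ hn] := compact_level cs 0 cC oUg CU.
have [s [us sC sep scov]] := compact_cosets cs n cC.
pose W := \big[setU/set0]_(x <- s) lcoset x (K n).
have [cW oW] : compact W /\ open W.
  rewrite /W; elim: (s) => [|a s' [IH1 IH2]].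
    by rewrite big_nil; split; [exact: compact0|exact: open0].
  rewrite big_cons; split; last by apply: openU => //; exact: (cs_open cs).
  by apply: compactU => //; apply: compact_lcoset; exact: cob_compact.
have CW : C `<=` W by rewrite /W -bigcup_seq => z /scov[x xs xz]; exists x.
have WU : W `<=` rcoset U g.
  by rewrite /W -bigcup_seq => z [x /= /sC Cx]; exact: hn.
have fW := fC cW; have cWg := compact_rcoset (g:=(g^-1)%g) cW.
apply: (@le_trans _ _ (mu W)).
  by apply: le_measure => //; rewrite inE; [exact: compact_measurable|case: fW].
rewrite (fin_measE fW) -/(vol mu W).
have -> : vol mu W = D g * vol mu (rcoset W (g^-1)%g).
  have := vol_rcoset_co g cWg (open_rcoset (g^-1)%g oW).
  by rewrite -rcosetM mulVg rcoset1.
rewrite EFinM -(fin_measE (fC cWg)) lee_pmul2l// ?lte_fin//.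
apply: le_measure; rewrite ?inE.
- exact: compact_measurable.
- exact: open_measurable.
by move=> z /rcosetP /WU /rcosetP; rewrite invgK mulgK.
Qed.

Let mu_rcoset_le (A : set (borel G)) g : measurable A ->
  (((D g)^-1)%:E * mu (rcoset (A : set G) g) <= mu A)%E.
Proof.
move=> mA; rewrite [leRHS](haar_outer hmu mA); apply: le_ereal_inf_tmp => _ [U [oU AU] <-].
rewrite lee_pdivrMl ?lte_fin//.
apply: le_trans (mu_rcoset_open g oU); apply: le_measure; rewrite ?inE.
- exact: measurable_rcoset.
- by apply: open_measurable; exact: open_rcoset.
by move=> z /rcosetP /AU Uz; apply/rcosetP.
Qed.

(** The reverse inequality is the direct one for the inverse of [g]. *)
Lemma modular_function_exists : exists Delta, modular_function mu Delta.
Proof.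
exists D => g; split=> // A mA; rewrite -/(rcoset (A : set G) g).
apply/le_anti/andP; split.
  by have := mu_rcoset_le g mA; rewrite lee_pdivrMl ?lte_fin.
have := mu_rcoset_le (g^-1)%g (measurable_rcoset g mA).
rewrite -rcosetM mulgV rcoset1.
have -> : (D (g^-1)%g)^-1 = D g.
  by rewrite -[RHS]mul1r -(mulVf (lt0r_neq0 (D_gt0 (g^-1)%g))) -mulrA DV mulr1.
by [].
Qed.

End modular_function_exists.

(** * Closed subgroups, orbit counts and commutants *)

Section subgroup_basis.
Variables (G : topologicalGroupType) (H : groupClosed G).
Let SH := subgroup_type H.

Lemma sval1 : val (1%g : SH) = 1%g :> G. Proof. by []. Qed.
Lemma svalM (x y : SH) : val (x * y)%g = (val x * val y)%g :> G. Proof. by []. Qed.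
Lemma svalV (x : SH) : val (x^-1)%g = (val x)^-1%g :> G. Proof. by []. Qed.

Lemma nbhs_subgroup (x : SH) (V : set SH) : nbhs x V ->
  exists U : set G, [/\ open U, U (val x) & val @^-1` U `<=` V].
Proof. by rewrite nbhsE => -[_ [[U oU <-] Ux] UV]; exists U. Qed.

Lemma nbhs_subgroup_preimage (x : SH) (U : set G) :
  nbhs (val x) U -> nbhs x (val @^-1` U).
Proof. exact: subgroup_val_continuous. Qed.

Lemma hausdorff_subgroup : hausdorff_space G -> hausdorff_space SH.
Proof.
move=> hG x y xy; apply: val_inj; apply: hG => A B nA nB.
have [z [Az Bz]] := xy _ _ (nbhs_subgroup_preimage nA) (nbhs_subgroup_preimage nB).
by exists (val z).
Qed.

Lemma compact_subgroup (A : set G) : closed [set` H] -> compact A ->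
  compact (val @^-1` A : set SH).
Proof.
move=> cH cA F PF FA.
pose F' : set_system G := [set B | F (val @^-1` B)].
have PF' : ProperFilter F'.
  split; first by rewrite /F' /= preimage_set0; exact: filter_not_empty.
  split.
  - by rewrite /F' /= preimage_setT; exact: filterT.
  - by move=> P Q FP FQ; exact: filterI FP FQ.
  - by move=> P Q PQ; apply: filterS => z; exact: PQ.
have [x [Ax clx]] := cA F' PF' FA.
have Hx : x \in H.
  apply: cH => B nB.
  have [|z [Hz Bz]] := clx [set` H] B _ nB; last by exists z.
  rewrite /F' /= (_ : _ @^-1` _ = setT); first exact: filterT.
  by apply/seteqP; split=> // z _; exact: (valP z).
pose y : SH := Sub x Hx; exists y; split=> //.
move=> S V FS nV; have [U [oU Uy UV]] := nbhs_subgroup nV.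
pose S' : set G := [set val (z : SH) | z in S].
have [||z [[w Sw <-] Uz]] := clx S' U.
- by apply: (@filterS _ F _ S) => // w Sw; exists w.
- exact: open_nbhs_nbhs.
by exists w; split=> //; exact: UV.
Qed.

Variable K : nat -> set G.
Hypothesis cobK : compact_open_basis K.
Hypothesis H_closed : closed [set` H].

Definition trace n : set SH := val @^-1` K n.

Lemma traceE n x : trace n x = K n (val x). Proof. by []. Qed.

Lemma subgroup_compact_open_basis : compact_open_basis trace.
Proof.
split.
- move=> n; split; first by rewrite traceE sval1; exact: (sg1 (cob_subgroup cobK n)).
  move=> x y; rewrite !traceE svalM svalV.
  exact: (cob_subgroup cobK n).2.
- by move=> n; apply: compact_subgroup => //; exact: (cob_compact cobK).
- by move=> n; exists (K n) => //; exact: cob_open.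
have [K1 [K2 K3]] := cob_basis cobK; split; [|split].
- by move=> n; apply: nbhs_subgroup_preimage; rewrite sval1.
- by move=> n x; exact: K2.
- move=> V /nbhs_subgroup[U [oU U1 UV]].
  have [|n hn] := K3 U.
    by apply: open_nbhs_nbhs; split=> //; move: U1; rewrite sval1.
  by exists n; apply: subset_trans UV => x; exact: hn.
Qed.

Section volumes.
Variables (R : realType) (mu : {measure set (borel G) -> \bar R}).
Variable muH : {measure set (borel SH) -> \bar R}.
Hypothesis G_hausdorff : hausdorff_space G.
Hypothesis hmu : left_haar mu.
Hypothesis hmuH : left_haar muH.

(** The cosets of [trace n] in [trace 0] generate distinct cosets of [K n] in
    [K 0], so the first index is at most the second. *)
Lemma vol_trace_ge n : vol muH (trace 0) / vol mu (K 0) * vol mu (K n) <= vol muH (trace n).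
Proof.
have hH := hausdorff_subgroup G_hausdorff.
have cobL := subgroup_compact_open_basis.
have fL m : fin_meas muH (trace m) by exact: fin_measK cobL m.
have fK m : fin_meas mu (K m) by exact: fin_measK cobK m.
have [s ps sL] : exists2 s : seq SH,
    partition_by (trace 0) s (fun x => lcoset x (trace n)) & forall x, x \in s -> trace 0 x.
  apply: (coset_partition (n := n) (lcoset_system cobL)); first exact: cob_compact cobL 0.
  move=> x Lx y /lcosetP /(cob_homo cobL (leq0n n)) h.
  by rewrite -(mulVKg x y); exact: (sgM (cob_subgroup cobL 0)).
have E1 : vol muH (trace 0) = (size s)%:R * vol muH (trace n).
  rewrite (vol_partition (fL 0) _ ps); last first.
    by move=> x _; case: (fin_meas_lcoset hmuH x (fL n)).
  by apply: sum_const_seq => x _; rewrite vol_lcoset.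
pose W : set (borel G) := \big[setU/set0]_(x <- s) lcoset (val x) (K n).
have WE z : W z <-> exists2 x, x \in s & lcoset (val x) (K n) z.
  rewrite /W -bigcup_seq; split; first by move=> [x /= xs xz]; exists x.
  by move=> [x xs xz]; exists x.
have pW : partition_by W s (fun x => lcoset (val x) (K n)).
  split=> //; first exact: part_uniq ps.
  move=> x y xs ys z xz yz; apply: (part_disj ps xs ys (z := y)); last first.
    exact: (cs_refl (lcoset_system cobL)).
  rewrite lcosetP traceE svalM svalV -lcosetP.
  rewrite -(lcoset_eq (cob_subgroup cobK n) xz) (lcoset_eq (cob_subgroup cobK n) yz).
  exact: (cs_refl (lcoset_system cobK)).
have WK : W `<=` K 0.
  move=> z /WE[x /sL Kx /lcosetP /(cob_homo cobK (leq0n n)) h].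
  by rewrite -(mulVKg (val x) z); exact: (sgM (cob_subgroup cobK 0)).
have fW : fin_meas mu W.
  rewrite /W; elim: (s) => [|a s' IH]; first by rewrite big_nil; exact: fin_meas0.
  by rewrite big_cons; apply: fin_measU => //; exact: fin_meas_lcoset.
have := vol_le fW (fK 0) WK.
rewrite (vol_partition fW _ pW); last first.
  by move=> x _; case: (fin_meas_lcoset hmu (val x) (fK n)).
rewrite (sum_const_seq (c := vol mu (K n))); last by move=> x _; rewrite vol_lcoset.
move=> le; have v0 := volK_gt0 G_hausdorff hmu cobK 0.
rewrite mulrAC ler_pdivrMr// E1 -mulrA mulrCA.
by rewrite ler_wpM2l ?vol_ge0.
Qed.

Lemma many_conjugates_trace (x : SH) : many_conjugates mu K [set` H] (val x) ->
  many_conjugates muH trace setT x.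
Proof.
move=> orb C N.
have v0 := volK_gt0 G_hausdorff hmu cobK 0.
have w0 := volK_gt0 (hausdorff_subgroup G_hausdorff) hmuH subgroup_compact_open_basis 0.
pose rho := vol muH (trace 0) / vol mu (K 0).
have rho0 : 0 < rho by rewrite divr_gt0.
(* [rho] compares the volumes of [trace n] and [K n], by [vol_trace_ge]. *)
have [n [p [h [Nn hH hinj Cp]]]] := orb (C / rho ^+ 2) N.
pose h' i : SH := Sub (h i) (hH i).1.
have vh i : val (h' i) = h i by rewrite SubK.
exists n, p, h'; split=> //.
- move=> i; split=> //; have [_ hK] := hH i.
  apply/seteqP; split=> z; rewrite conjsetE lcosetP rcosetP !traceE !(svalM, svalV) vh => h1.
    by rewrite -hK conjsetE lcosetP rcosetP.
  by move: h1; rewrite -{1}hK conjsetE lcosetP rcosetP.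
- move=> i j; rewrite lcosetP traceE !(svalM, svalV) !vh -lcosetP.
  exact: hinj.
- move: Cp; rewrite ltr_pdivrMr ?exprn_gt0// => Cp; apply: lt_le_trans Cp _.
  rewrite -mulrA ler_wpM2l// -exprMn ler_pXn2r ?nnegrE ?vol_ge0//.
    by rewrite mulrC; exact: vol_trace_ge.
  by rewrite mulr_ge0 ?vol_ge0// ltW.
Qed.

End volumes.
End subgroup_basis.

Section orbit_counts.
Variables (R : realType) (G : topologicalGroupType).
Variable mu : {measure set (borel G) -> \bar R}.

Lemma limn_esup_pinfty (u : nat -> \bar R) (C : R) N : limn_esup u = +oo%E ->
  exists2 n, (N <= n)%N & (C%:E < u n)%E.
Proof.
move=> u_oo; have : (C%:E < ereal_sup [set u n | n in [set n | (N <= n)%N]])%E.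
  apply: (@lt_le_trans _ _ +oo%E); first by rewrite ltry.
  rewrite -u_oo; apply: ereal_inf_lbound; exists [set n | (N <= n)%N] => //.
  by exists N.
by move=> /ereal_sup_gt[_ [n Nn <-] Cn]; exists n.
Qed.

Lemma conjset_lcoset (K : set G) h x : conjset h K = K ->
  conjset h (lcoset x K) = lcoset (h * x * h^-1)%g K.
Proof.
move=> hK; rewrite conjsetE lrcoset -lcosetM -{2}hK conjsetE -lcosetM.
by congr lcoset; rewrite -!mulgA mulVg mulg1.
Qed.

Lemma counting_seq (T : choiceType) (S : set T) (C c : R) : 0 < c ->
  (C%:E < counting S * c%:E)%E ->
  exists s : seq T, [/\ uniq s, forall x, x \in s -> S x & C < (size s)%:R * c].
Proof.
move=> c0; rewrite /counting; case: asboolP => [fS|iS] lt.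
  exists (finmap.enum_fset (fset_set S)); split.
  - exact: finmap.fset_uniq.
  - by move=> x; rewrite in_fset_set// inE.
  - by move: lt; rewrite -EFinM lte_fin.
have [B BS sB] := infinite_set_fset (Num.truncn (C / c)).+1 iS.
exists (finmap.enum_fset B); split; first exact: finmap.fset_uniq.
- by move=> x xB; exact: BS.
- rewrite -ltr_pdivrMr//; apply: lt_le_trans (truncnS_gt _) _.
  by rewrite ler_nat.
Qed.

Lemma many_conjugates_limsup (K : nat -> set G) (H : groupClosed G) x :
  (forall n, subgroup_set (K n)) -> (forall n, fin_meas mu (K n)) -> (forall n, 0 < vol mu (K n)) ->
  limn_esup (fun n => conj_orbit_card R H (K n) x * mu (K n) ^+ 2)%E = +oo%E ->
  many_conjugates mu K [set` H] x.
Proof.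
move=> sgK fK v0 oo C N; have [n Nn] := limn_esup_pinfty C N oo.
rewrite (fin_measE (fK n)) -/(vol mu (K n)) -EFin_expe.
move=> /counting_seq[|s [us sS Cs]]; first by rewrite exprn_gt0.
have /choice[h hP] : forall i : 'I_(size s), exists h : G,
    normalizer_in H (K n) h /\ conjset h (lcoset x (K n)) = nth set0 s i.
  by move=> i; have [h hN hE] := sS _ (mem_nth set0 (ltn_ord i)); exists h.
exists n, (size s), h; split=> //; first by move=> i; have [[]] := hP i.
move=> i j /(lcoset_eq (sgK n)).
have [[_ Ki] Ei] := hP i; have [[_ Kj] Ej] := hP j.
rewrite -!conjset_lcoset// Ei Ej => /eqP; rewrite nth_uniq// => /eqP ij.
exact/val_inj/esym.
Qed.

End orbit_counts.

Section commutants.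
Context d (T : measurableType d) (R : realType) (mu : {measure set T -> \bar R}).
Implicit Types (S : set (L2 mu -> L2 mu)) (A : L2 mu -> L2 mu).

Lemma sub_bicommutant S A : bounded_op A -> S A -> bicommutant S A.
Proof. by move=> bA SA; split=> // B [_ hB]; rewrite hB. Qed.

Lemma commutant_anti S S' : S `<=` S' -> commutant S' `<=` commutant S.
Proof. by move=> SS' A [bA hA]; split=> // B /SS'/hA. Qed.

Lemma scalar_commutant S A : S `<=` @bounded_op _ _ _ mu -> scalar_ops A -> commutant S A.
Proof.
move=> Sb [c ->]; split.
  by apply: (bounded_scale c (A := id)); split=> //; exists 1 => xi; rewrite mul1r.
by move=> B /Sb[lB _]; apply/funext => xi; rewrite /= (linZ lB).
Qed.

Lemma scalar_bicommutant S A : scalar_ops A -> bicommutant S A.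
Proof. by apply: scalar_commutant => B []. Qed.

End commutants.

Section factor.
Variables (R : realType) (G : topologicalGroupType).
Variable mu : {measure set (borel G) -> \bar R}.
Hypothesis hmu : left_haar mu.
Hypothesis G_hausdorff : hausdorff_space G.
Variables (Delta : G -> R) (K : nat -> set G) (H : set G).
Hypothesis Delta_modular : modular_function mu Delta.
Hypothesis cobK : compact_open_basis K.
Hypothesis orbits : forall x, x != 1%g -> many_conjugates mu K H x.

Lemma relative_commutant_trivial :
  commutant (bicommutant (left_regular hmu @` H)) `&`
    bicommutant (range (left_regular hmu)) = @scalar_ops _ _ R mu.
Proof.
apply/seteqP; split=> T; last first.
  by move=> sT; split; [apply: scalar_commutant => // B []|exact: scalar_bicommutant].
move=> [[bT TH] [_ TG]].
apply: (commuting_scalar G_hausdorff hmu Delta_modular cobK orbits (T := T)).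
split=> // [h Hh xi|g xi].
  have : (T \o left_regular hmu h) xi = (left_regular hmu h \o T) xi.
    rewrite TH//; apply: sub_bicommutant; last by exists h.
    by rewrite left_regular_ltrans_op; exact: ltrans_op_bounded.
  by rewrite /= left_regular_ltrans_op.
suff : T \o rtrans_op g = rtrans_op g \o T by move=> /(congr1 (fun f => f xi)).
apply: TG; split; first exact: (rtrans_op_bounded Delta_modular).
by move=> _ [h _ <-]; rewrite left_regular_ltrans_op (ltrans_rtrans_op hmu Delta_modular).
Qed.

Lemma left_regular_factorial : is_factorial (left_regular hmu).
Proof.
apply/seteqP; split=> T; last first.
  by move=> sT; split; [exact: scalar_bicommutant|apply: scalar_commutant => // B []].
move=> [TG TH]; rewrite -relative_commutant_trivial; split=> //.
by move: T TH {TG}; do 3 apply: commutant_anti; exact: image_subset.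
Qed.

End factor.

(** * Triviality of the relative commutant *)

Theorem theorem0p2 (R : realType) (G : topologicalGroupType)
    (G_hausdorff : hausdorff_space G)
    (G_locally_compact : locally_compact [set: G])
    (G_totally_disconnected : totally_disconnected [set: G])
    (mu : {measure set (borel G) -> \bar R}) (mu_haar : left_haar mu)
    (Delta : G -> R) (Delta_modular : modular_function mu Delta)
    (H : groupClosed G) (H_closed : closed [set` H])
    (H_kerDelta : forall h, h \in H -> Delta h = 1)
    (H_orbits : exists K : nat -> groupClosed G,
      [/\ forall n, compact [set` K n] /\ open [set` K n],
          nbhs_basis1 (fun n => [set` K n]) &
          forall g : G, g != 1%g ->
            limn_esup (fun n =>
              conj_orbit_card R H [set` K n] g * mu [set` K n] ^+ 2)%E = +oo%E]) :
  [/\ commutant (bicommutant (left_regular mu_haar @` [set` H])) `&`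
        bicommutant (range (left_regular mu_haar)) = @scalar_ops _ _ R mu,
      is_factorial (left_regular mu_haar) &
      forall (muH : {measure set (borel (subgroup_type H)) -> \bar R})
        (muH_haar : left_haar muH), is_factorial (left_regular muH_haar)].
Proof.
have [K [Kco Kbasis Korb]] := H_orbits.
pose K' n : set G := [set` K n].
have cobK : compact_open_basis K'.
  split=> // n; try by case: (Kco n).
  split; first exact: gpred1.
  by move=> x y Kx Ky; apply: gpredM => //; exact: gpredVr.
have sgK n := cob_subgroup cobK n.
have orbits x : x != 1%g -> many_conjugates mu K' [set` H] x.
  move=> /Korb; apply: many_conjugates_limsup => // n.
  - exact: (fin_measK G_hausdorff mu_haar cobK).
  - exact: (volK_gt0 G_hausdorff mu_haar cobK).
split.
- exact: (relative_commutant_trivial mu_haar G_hausdorff Delta_modular cobK orbits).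
- exact: (left_regular_factorial mu_haar G_hausdorff Delta_modular cobK orbits).
move=> muH muH_haar.
have hH := hausdorff_subgroup (H := H) G_hausdorff.
have cobL := subgroup_compact_open_basis cobK H_closed.
have [DeltaH DeltaH_modular] := modular_function_exists hH muH_haar cobL.
apply: (left_regular_factorial muH_haar hH DeltaH_modular cobL (H := setT)) => x x1.
apply: (many_conjugates_trace cobK H_closed G_hausdorff mu_haar muH_haar).
apply: orbits; apply: contra x1 => /eqP vx; apply/eqP/val_inj.
by rewrite vx.
Qed.
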